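(* Let $p>1$. Let $(X,\mathcal{A},e)$ be SPQR relatively hyperbolic, where $\mathcal{A}=\{A_i:i\in I\}$. Suppose we are given maps $\psi_i:A_i\to\ell^p(X_i)$ and a concave function $\rho':\mathbb{R}_{\geq0}\to\mathbb{R}_{\geq0}$ such that for all $i$ and all $x,y\in A_i$, \[ \rho'(d(x,y))\leq\|\psi_i(x)-\psi_i(y)\|_p\leq d(x,y). \] Then for every function $f:\mathbb{N}\to\mathbb{R}_{\geq0}$ with property $(C_p^c)$ there exists a coarse embedding $\phi$ of $X$ into some $\ell^p$ space such that for all $x,y\in X$, \[ \rho(d(x,y))\preceq\|\phi(x)-\phi(y)\|_p\preceq d(x,y), \] where $\rho(n)=\min\{\rho'(n),f(n)\}$.
   Context: Setting: $X$ is the vertex set of a connected simplicial graph of bounded geometry (uniformly bounded degree) with shortest path metric $d$, $e\in X$ a basepoint, and $\mathcal{A}=\{A_i\}_{i\in I}$ a countable collection of subsets (''pieces'') covering $X$. All geodesics considered run from a point $x$ to $e$. For such a geodesic $g$ meeting $A_i$, its $i$-domain $g|_i$ is the convex hull in $g$ of $g\cap A_i$; viewing it as directed from $x$ towards $e$, $g|_i^+$ is its initial vertex and $g|_i^-$ its terminal vertex; the $i$-length is $l_i(g)=d(g|_i^-,g|_i^+)+1$. For $x\in X$, $k\in\mathbb{N}$, let $G_{x,k}$ be the set of all geodesics from points $y$ with $d(x,y)\leq k$ to $e$. For a set $G$ of such geodesics and $K\geq1$, $\partial_i^K(G)$ is the set of points $g|_i^+$ ($g\in G$ meeting $A_i$)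 such that for all $g'\in G$ and all $j\in I$ with $l_j(g')\geq5K$, $d(e,g|_i^+)\notin[d(e,g'|_j^-)+2K,\,d(e,g'|_j^+)-2K]$. Set $\partial_i^K(x)=\bigcup_{k\leq d(x,A_i)/4}\partial_i^K(G_{x,k})$ and let $I_x(K)$ be the set of $i\in I$ with $\partial_i^K(x)\neq\emptyset$ and $d(e,\partial_i^K(x))\geq3K$. $(X,\mathcal{A},e)$ is SPQR relatively hyperbolic if there is a constant $K>0$ such that: (C1) for every $i$ and any two geodesics (ending at $e$) $g_1,g_2$ meeting $A_i$, $d(g_1|_i^-,g_2|_i^-)\leq K$; (C2) for every $i$, all $x,y$ with $d(x,y)\leq\max\{d(x,A_i)/4,1\}$ and all geodesics $g_x$ from $x$ to $e$ and $g_y$ from $y$ to $e$ both meeting $A_i$, $d(g_x|_i^+,g_y|_i^+)\leq K$, and moreover if $g_x$ meets $A_i$ but $g_y\cap A_i=\emptyset$ then $l_i(g_x)\leq K$; (C3) $1\leq|\{i:x\in A_i\}|\leq K$ for all $x$ and $\mathrm{diam}(A_i\cap A_j)\leq K$ for $i\neq j$; (C4) $|\{i\in I_x(K):d(x,A_i)=t\}|\leq K$ for all $x\in X$ and $t\in\mathbb{N}$. A function is concave if non-decreasing with $f(n+m)-f(n)\leq f(n)-f(n-m)$ for $n\geq m$. $f$ has $(C_p^c)$ if it is concave, $\sum_{n\geq1}\frac1n\left(\frac{f(n)}n\right)^p<\infty$, and $f(n)^p/n$ is non-decreasing for all sufficiently large $n$. $A\preceq B$ means $A\leq CB+C$ for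 a constant $C$ independent of $x,y$.
   Formalization: That φ is a ''coarse embedding'' is not asserted separately, only the two displayed inequalities are; if ρ' is bounded the separate claim can fail (A={X}, X containing expanders, ψ=0, ρ'=0), and if ρ' is unbounded it follows from the inequalities (for f=0, apply them to another f). *)

(* Defs.v *)
From HB Require Import structures.
From mathcomp Require Import all_boot all_order all_algebra.
From mathcomp Require Import all_classical all_reals all_analysis.
Set Implicit Arguments. Unset Strict Implicit. Unset Printing Implicit Defensive.
Import Order.TTheory GRing.Theory Num.Theory.
Local Open Scope classical_set_scope.
Local Open Scope ring_scope.

Definition walk {X : Type} (adj : X -> X -> Prop) (n : nat) (x y : X) : Prop :=
  exists w : nat -> X, w 0%N = x /\ w n = y /\ forall k, (k < n)%N -> adj (w k) (w k.+1).

Lemma walk_asbool_ex {X : Type} (adj : X -> X -> Prop) (x y : X) :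
  (exists n, walk adj n x y) -> exists n, `[< walk adj n x y >].
Proof. by move=> [n h]; exists n; apply/asboolP. Qed.

(* shortest path distance (0 by convention if no walk exists; irrelevant for
   connected graphs) *)
Definition gdist {X : Type} (adj : X -> X -> Prop) (x y : X) : nat :=
  match pselect (exists n, walk adj n x y) with
  | left h => ex_minn (walk_asbool_ex h)
  | right _ => 0%N
  end.

Definition bounded_geometry_graph {X : choiceType} (adj : X -> X -> Prop) : Prop :=
  (forall x y, adj x y -> adj y x) /\
  (forall x, ~ adj x x) /\
  (forall x y, exists n, walk adj n x y) /\
  (exists D : nat, forall x, exists s : seq X,
      (forall y, adj x y -> y \in s) /\ (size s <= D)%N).

(* a geodesic is encoded by its length n and its vertex sequence g 0, ..., g n;
   it runs from g 0 to e *)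
Definition geo (X : Type) := (nat * (nat -> X))%type.

Definition is_geod {X : Type} (adj : X -> X -> Prop) (e : X) (gm : geo X) : Prop :=
  let: (n, g) := gm in
  g n = e /\ n = gdist adj (g 0%N) e /\ forall k, (k < n)%N -> adj (g k) (g k.+1).

Definition gstart {X : Type} (gm : geo X) : X := gm.2 0%N.

Definition meets {X : Type} (gm : geo X) (A : set X) : Prop :=
  exists k, (k <= gm.1)%N /\ A (gm.2 k).

(* first / last index of g in A (meaningful when g meets A) *)
Definition kmin {X : Type} (gm : geo X) (A : set X) : nat :=
  \big[minn/gm.1]_(k < gm.1.+1 | `[< A (gm.2 k) >]) (k : nat).
Definition kmax {X : Type} (gm : geo X) (A : set X) : nat :=
  \max_(k < gm.1.+1 | `[< A (gm.2 k) >]) (k : nat).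

Definition dplus {X : Type} (gm : geo X) (A : set X) : X := gm.2 (kmin gm A).
Definition dminus {X : Type} (gm : geo X) (A : set X) : X := gm.2 (kmax gm A).

Definition ilen {X : Type} (adj : X -> X -> Prop) (gm : geo X) (A : set X) : nat :=
  (gdist adj (dminus gm A) (dplus gm A)).+1.

(* distance from a point to a set (infimum; used only for nonempty sets) *)
Definition dset {R : realType} {X : Type} (adj : X -> X -> Prop) (x : X) (A : set X) : R :=
  inf [set ((gdist adj x a)%:R : R) | a in A].

Definition Gxk {X : Type} (adj : X -> X -> Prop) (e x : X) (k : nat) : set (geo X) :=
  [set gm | is_geod adj e gm /\ (gdist adj x (gstart gm) <= k)%N].

Definition bdry {R : realType} {X : Type} {I : Type} (adj : X -> X -> Prop) (e : X)
  (A : I -> set X) (K : R) (G : set (geo X)) (i : I) : set X :=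
  [set z | (exists2 g, G g & meets g (A i) /\ z = dplus g (A i)) /\
     forall g' j, G g' -> meets g' (A j) ->
       5 * K <= ((ilen adj g' (A j))%:R : R) ->
       ~ ((gdist adj e (dminus g' (A j)))%:R + 2 * K <= ((gdist adj e z)%:R : R)
          /\ ((gdist adj e z)%:R : R) <= (gdist adj e (dplus g' (A j)))%:R - 2 * K)].

Definition bdryx {R : realType} {X : Type} {I : Type} (adj : X -> X -> Prop) (e : X)
  (A : I -> set X) (K : R) (x : X) (i : I) : set X :=
  [set z | exists k : nat, ((k%:R : R) <= dset adj x (A i) / 4) /\
                           bdry adj e A K (Gxk adj e x k) i z].

Definition Ix {R : realType} {X : Type} {I : Type} (adj : X -> X -> Prop) (e : X)
  (A : I -> set X) (K : R) (x : X) : set I :=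
  [set i | bdryx adj e A K x i !=set0 /\ 3 * K <= dset (R := R) adj e (bdryx adj e A K x i)].

Definition card_le {R : realType} {I : eqType} (P : set I) (K : R) : Prop :=
  exists s : seq I, (forall i, P i -> i \in s) /\ ((size s)%:R <= K).

Definition SPQR {R : realType} {X : Type} {I : eqType} (adj : X -> X -> Prop)
  (A : I -> set X) (e : X) : Prop :=
  exists K : R, 0 < K /\
  (forall i g1 g2, is_geod adj e g1 -> is_geod adj e g2 ->
     meets g1 (A i) -> meets g2 (A i) ->
     ((gdist adj (dminus g1 (A i)) (dminus g2 (A i)))%:R <= K)) /\
  (forall i x y, (((gdist adj x y)%:R : R) <= Num.max (dset adj x (A i) / 4) 1) ->
     forall gx gy, is_geod adj e gx -> gstart gx = x ->
                   is_geod adj e gy -> gstart gy = y ->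
     (meets gx (A i) -> meets gy (A i) ->
        ((gdist adj (dplus gx (A i)) (dplus gy (A i)))%:R <= K)) /\
     (meets gx (A i) -> ~ meets gy (A i) -> ((ilen adj gx (A i))%:R <= K))) /\
  (forall x, (exists i, A i x) /\ card_le [set i | A i x] K) /\
  (forall i j, i <> j -> forall a b, (A i `&` A j) a -> (A i `&` A j) b ->
     ((gdist adj a b)%:R <= K)) /\
  (forall x (t : nat),
     card_le [set i | Ix adj e A K x i /\ dset adj x (A i) = (t%:R : R)] K).

Definition lp_mem {R : realType} {S : choiceType} (p : R) (v : S -> R) : Prop :=
  (\esum_(s in [set: S]) ((`|v s| `^ p)%:E) < +oo)%E.

Definition lpnorm {R : realType} {S : choiceType} (p : R) (v : S -> R) : R :=
  (fine (\esum_(s in [set: S]) ((`|v s| `^ p)%:E))) `^ (p^-1).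

Definition concave_nat {R : realType} (f : nat -> R) : Prop :=
  (forall n m, (n <= m)%N -> f n <= f m) /\
  (forall n m, (m <= n)%N -> f (n + m)%N - f n <= f n - f (n - m)%N).

Definition concave_nonneg {R : realType} (f : R -> R) : Prop :=
  (forall t, 0 <= t -> 0 <= f t) /\
  (forall s t, 0 <= s -> s <= t -> f s <= f t) /\
  (forall n m, 0 <= m -> m <= n -> f (n + m) - f n <= f n - f (n - m)).

Definition Cpc {R : realType} (p : R) (f : nat -> R) : Prop :=
  concave_nat f /\
  (\esum_(n in [set n : nat | (0 < n)%N])
      (((n%:R)^-1 * (f n / n%:R) `^ p)%:E) < +oo)%E /\
  (exists N : nat, forall n m, (N <= n)%N -> (n <= m)%N ->
      f n `^ p / n%:R <= f m `^ p / m%:R).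

(* Main.v *)
(* Writing [r_i(x) = d(x, A_i)] and letting [gam x] be a chosen geodesic from [x]
   to [e], map [x] to the sum of three fields, where [eta n] is essentially
   [f(n) / n^(1+1/p)], so that [sum eta^p < oo] while [n * (n * eta(n))^p] is
   [f(n)^p]:
   - short pieces: on [(i, z)], [eta(r_i(x))] times a tent of height [r_i(x) + 1]
     measuring how close to [x] starts a geodesic entering [A_i] at [z], minus the
     tent of the geodesics that exclude [z] in the sense of the K-boundary.  Its
     support lies in the K-boundary, so (C4) bounds the number of active pieces at
     each distance;
   - long pieces: the same on [(i, z, m)] with [m] up to the length of the domain,
     so that a domain of length [l] counts [l] times.  Here (C2) makes [gam x]
     itself meet the piece and coordinates are counted along [gam x];
   - inside a piece: the average over nearby geodesics of [psi_i] at the entry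
     point minus [psi_i] at the common exit point.
   In each field an edge changes a coordinate by O(eta(r_i)) and boundedly many
   coordinates have a given [r_i], whence the Lipschitz bound.  For the lower bound
   let [n = d(x, y)] and let [x] be at least as far from [e] as [y].  Either a
   domain of [gam x] starts near [x] and is longer than a fixed proportion of [n];
   then the entry points of [x] and [y] are far apart and the third field gives
   [rho'(n)].  Or a proportion of the first [n/4] vertices of [gam x] yields
   distinct coordinates of the first two fields, of size [eta(n) * n] at [x] and
   [0] at [y], and their total is [f(n)^p]. *)

Require Import Defs.
From HB Require Import structures.
From mathcomp Require Import all_boot all_order all_algebra.
From mathcomp Require Import all_classical all_reals all_analysis.
From mathcomp Require finmap.
From mathcomp Require Import zify ring lra.
Set Implicit Arguments. Unset Strict Implicit. Unset Printing Implicit Defensive.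
Import Order.TTheory GRing.Theory Num.Theory.
Local Open Scope classical_set_scope.
Local Open Scope ring_scope.

(* Topology also defines [meets]; here it always means that a geodesic meets a
   piece. *)
Local Notation meets := Defs.meets.

(** * Monotonicity and convexity of [t ^ p] *)

Section Powers.
Variables (R : realType) (p : R).
Hypothesis hp : 1 <= p.

Let p0 : 0 < p. Proof. exact: lt_le_trans hp. Qed.

Lemma powR_ler (a b : R) : 0 <= a -> a <= b -> a `^ p <= b `^ p.
Proof.
move=> a0 ab; apply: ge0_ler_powR => //; first exact: ltW.
  by rewrite nnegrE (le_trans a0).
Qed.

Lemma powR_ler_inv (a b : R) : 0 <= a -> 0 <= b -> a `^ p <= b `^ p -> a <= b.
Proof.
move=> a0 b0 h; have := @ge0_ler_powR R (p^-1) _ (a `^ p) (b `^ p).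
rewrite -!powRrM mulfV ?gt_eqF// !powRr1//; apply => //; rewrite ?nnegrE ?powR_ge0//.
by rewrite invr_ge0 ltW.
Qed.

Lemma powR_conv (t x y : R) : 0 <= t -> t <= 1 -> 0 <= x -> 0 <= y ->
  (t * x + (1 - t) * y) `^ p <= t * x `^ p + (1 - t) * y `^ p.
Proof.
move=> t0 t1 x0 y0.
have := @convex_powR R p hp (Itv01 t0 t1) x y.
rewrite !inE /= !in_itv /= !andbT => /(_ x0 y0).
by rewrite !convRE.
Qed.

End Powers.

(** * Bounds for [p]-norms, tested on finite lists *)

Section Lple.
Variables (R : realType) (p : R).
Hypothesis hp : 1 < p.

Let hp1 : 1 <= p. Proof. exact: ltW. Qed.
Let p0 : 0 < p. Proof. exact: lt_trans hp. Qed.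

(** For [0 <= a] this says that [v] is in [l^p] with norm at most [a]. Testing finite lists gives
    membership and the bound at once and keeps extended reals out of the estimates. *)
Definition lple (S : choiceType) (v : S -> R) (a : R) : Prop :=
  forall L : seq S, uniq L -> \sum_(s <- L) `|v s| `^ p <= a `^ p.

Lemma lple_mono (S : choiceType) (u v : S -> R) (a b : R) :
  (forall s, `|u s| <= `|v s|) -> 0 <= a -> a <= b -> lple v a -> lple u b.
Proof.
move=> uv a0 ab hv L uL; apply: le_trans (le_trans (hv L uL) _).
  by apply: ler_sum => s _; apply: powR_ler.
exact: powR_ler.
Qed.

Lemma lple_ext (S : choiceType) (u v : S -> R) (a : R) :
  u =1 v -> lple v a -> lple u a.
Proof. by move=> uv hv L uL; under eq_bigr => s _ do rewrite uv; exact: hv. Qed.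

Lemma lple0 (S : choiceType) (v : S -> R) (a : R) : (forall s, v s = 0) -> lple v a.
Proof.
move=> v0 L _; rewrite big1 ?powR_ge0// => s _.
by rewrite v0 normr0 powR0// gt_eqF.
Qed.

Lemma lple_coord (S : choiceType) (v : S -> R) (a : R) s :
  0 <= a -> lple v a -> `|v s| <= a.
Proof.
move=> a0 /(_ [:: s] isT); rewrite big_seq1; exact: powR_ler_inv.
Qed.

(** Minkowski's inequality from convexity: [|u| + |v|] is [a + b] times the combination of [|u| / a]
    and [|v| / b] with weights [a / (a + b)] and [b / (a + b)]. If [a] or [b] is 0, the
    corresponding function vanishes. *)
Lemma lple_add (S : choiceType) (u v : S -> R) (a b : R) :
  0 <= a -> 0 <= b -> lple u a -> lple v b -> lple (fun s => u s + v s) (a + b).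
Proof.
move=> a0 b0 hu hv.
have [a_eq0|an0] := eqVneq a 0.
  have u0 s : u s = 0.
    by apply/eqP; rewrite -normr_le0 -a_eq0; exact: lple_coord.
  by apply: (lple_ext (v := v)); [move=> s; rewrite u0 add0r | rewrite a_eq0 add0r].
have [b_eq0|bn0] := eqVneq b 0.
  have v0 s : v s = 0.
    by apply/eqP; rewrite -normr_le0 -b_eq0; exact: lple_coord.
  by apply: (lple_ext (v := u)); [move=> s; rewrite v0 addr0 | rewrite b_eq0 addr0].
have {an0}a1 : 0 < a by rewrite lt_def an0.
have {bn0}b1 : 0 < b by rewrite lt_def bn0.
have ab0 : 0 < a + b by apply: addr_gt0.
move=> L uL.
pose t := a / (a + b).
have t0 : 0 <= t by apply: divr_ge0 => //; exact: ltW.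
have t1 : t <= 1 by rewrite ler_pdivrMr// mul1r lerDl.
have tE : 1 - t = b / (a + b) by rewrite /t; field; rewrite gt_eqF.
have key s : `|u s + v s| `^ p <= (a + b) `^ p *
    (t * (a `^ p)^-1 * `|u s| `^ p + (1 - t) * (b `^ p)^-1 * `|v s| `^ p).
  have e1 : `|u s| + `|v s| = (a + b) * (t * (`|u s| / a) + (1 - t) * (`|v s| / b)).
    by rewrite tE /t; field; rewrite !gt_eqF.
  have ge1 : 0 <= `|u s| / a by apply: divr_ge0.
  have ge2 : 0 <= `|v s| / b by apply: divr_ge0.
  apply: (@le_trans _ _ ((`|u s| + `|v s|) `^ p)).
    by apply: powR_ler => //; exact: ler_normD.
  rewrite e1 powRM; [|exact: ltW|]; last first.
    by apply: addr_ge0; apply: mulr_ge0 => //; rewrite subr_ge0.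
  apply: ler_wpM2l; first exact: powR_ge0.
  apply: le_trans (powR_conv hp1 t0 t1 ge1 ge2) _.
  have dv (x y : R) : 0 <= x -> 0 < y -> (x / y) `^ p = (y `^ p)^-1 * x `^ p.
    move=> x0 y0; rewrite powRM ?invr_ge0 ?(ltW y0)// mulrC; congr (_ * _).
    by rewrite -powR_inv1 ?(ltW y0)// -powRrM mulN1r powRN.
  by rewrite !dv// !mulrA.
apply: le_trans (ler_sum _ (fun s _ => key s)) _.
rewrite -mulr_sumr big_split/= -!mulr_sumr -[leRHS]mulr1.
apply: ler_wpM2l; first exact: powR_ge0.
have nt x : 0 < x -> x `^ p != 0 by move=> x0; rewrite gt_eqF// powR_gt0.
rewrite -(mulrA t) -(mulrA (1 - t)).
have q1 : (a `^ p)^-1 * \sum_(s <- L) `|u s| `^ p <= 1.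
  by rewrite mulrC ler_pdivrMr ?powR_gt0// mul1r; exact: hu.
have q2 : (b `^ p)^-1 * \sum_(s <- L) `|v s| `^ p <= 1.
  by rewrite mulrC ler_pdivrMr ?powR_gt0// mul1r; exact: hv.
have t1' : 0 <= 1 - t by rewrite subr_ge0.
apply: (@le_trans _ _ (t * 1 + (1 - t) * 1)); first by apply: lerD; exact: ler_wpM2l.
by rewrite !mulr1 addrC subrK.
Qed.

Lemma lple_scale (S : choiceType) (v : S -> R) (a c : R) :
  0 <= a -> lple v a -> lple (fun s => c * v s) (`|c| * a).
Proof.
move=> a0 hv L uL.
under eq_bigr => s _ do rewrite normrM powRM//.
by rewrite -mulr_sumr powRM//; apply: ler_wpM2l; [exact: powR_ge0|exact: hv].
Qed.

Lemma lple_opp (S : choiceType) (v : S -> R) (a : R) :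
  lple v a -> lple (fun s => - v s) a.
Proof. by move=> hv L uL; under eq_bigr => s _ do rewrite normrN; exact: hv. Qed.

Lemma lple_sub (S : choiceType) (u v : S -> R) (a b : R) :
  0 <= a -> 0 <= b -> lple u a -> lple v b -> lple (fun s => u s - v s) (a + b).
Proof. by move=> a0 b0 hu hv; apply: lple_add => //; exact: lple_opp. Qed.

(** The norm bound on [v z] is asked only where [c z] is nonzero: in the averages below, only the
    points that carry weight are known to be close together. *)
Lemma lple_lincomb (S : choiceType) (T : eqType) (L : seq T) (c : T -> R)
    (v : T -> S -> R) (g a : R) : 0 <= g -> 0 <= a ->
  (forall z, z \in L -> `|c z| <= g) ->
  (forall z, z \in L -> c z != 0 -> lple (v z) a) ->
  lple (fun s => \sum_(z <- L) c z * v z s) ((size L)%:R * (g * a)).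
Proof.
move=> g0 a0; elim: L => [|z L IH] hc hv.
  by apply: lple0 => s; rewrite big_nil.
apply: (lple_ext (v := fun s => c z * v z s + \sum_(z <- L) c z * v z s)).
  by move=> s; rewrite big_cons.
have zz : z \in z :: L by rewrite inE eqxx.
rewrite [size _]/= -natr1 mulrDl mul1r addrC; apply: lple_add.
- exact: mulr_ge0.
- by apply: mulr_ge0 => //; exact: mulr_ge0.
- have [cz0|cz0] := eqVneq (c z) 0.
    by apply: lple0 => s; rewrite cz0 mul0r.
  apply: (lple_mono (v := fun s => c z * v z s) (a := `|c z| * a)) => //.
  + exact: mulr_ge0.
  + by apply: ler_wpM2r => //; exact: hc.
  + by apply: lple_scale => //; exact: hv.
- by apply: IH => w wL; [apply: hc|apply: hv]; rewrite inE wL orbT.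
Qed.

Lemma lple_inj (S S1 : choiceType) (f : S1 -> S) (v : S -> R) (a : R) :
  injective f -> lple v a -> lple (fun s => v (f s)) a.
Proof.
move=> fi hv L uL; have := hv (map f L); rewrite map_inj_uniq// big_map.
exact.
Qed.

(** Extending both restrictions by zero and applying Minkowski gives the constant [a + b], cruder
    than the [l^p] sum but sufficient. *)
Lemma lple_sum_type (S1 S2 : choiceType) (v : (S1 + S2)%type -> R) (a b : R) :
  0 <= a -> 0 <= b ->
  lple (fun s => v (inl s)) a -> lple (fun s => v (inr s)) b -> lple v (a + b).
Proof.
move=> a0 b0 h1 h2.
pose v1 (s : S1 + S2) := if s is inl _ then v s else 0.
pose v2 (s : S1 + S2) := if s is inr _ then v s else 0.
apply: (lple_ext (v := fun s => v1 s + v2 s)).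
  by case=> s; rewrite /v1 /v2 ?addr0 ?add0r.
have cut (L : seq (S1 + S2)) : uniq L ->
  exists L1 L2, [/\ uniq L1, uniq L2,
     \sum_(s <- L) `|v1 s| `^ p = \sum_(s <- L1) `|v (inl s)| `^ p,
     \sum_(s <- L) `|v2 s| `^ p = \sum_(s <- L2) `|v (inr s)| `^ p &
     (forall s, (s \in L1) = (inl s \in L)) /\ forall s, (s \in L2) = (inr s \in L)].
  elim: L => [|s L IH] /=; first by exists [::], [::]; rewrite !big_nil.
  move=> /andP[sL /IH [L1 [L2 [u1 u2 e1 e2 [m1 m2]]]]].
  case: s sL => s sL.
    exists (s :: L1), L2; rewrite /= m1 sL u1 u2 !big_cons e1 e2 /=.
    rewrite normr0 powR0 ?gt_eqF// add0r; split => //.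
    split=> t; first by rewrite !inE m1.
    by rewrite m2 inE.
  exists L1, (s :: L2); rewrite /= m2 sL u1 u2 !big_cons e1 e2 /=.
  rewrite normr0 powR0 ?gt_eqF// add0r; split => //.
  split=> t; last by rewrite !inE m2.
  by rewrite m1 inE.
apply: lple_add => // L /cut [L1 [L2 [u1 u2 e1 e2 _]]].
  by rewrite e1; exact: h1.
by rewrite e2; exact: h2.
Qed.

Lemma lple_sigT (I : choiceType) (T : I -> choiceType) (v : {i : I & T i} -> R)
    (b : I -> R) (a : R) :
  (forall i, 0 <= b i) -> (forall i, lple (fun s => v (existT (fun i : I => T i : Type) i s)) (b i)) ->
  lple b a -> lple v a.
Proof.
move=> b0 hv hb L uL.
have split_i i : exists2 Li : seq (T i), uniq Li &
    (forall s, (s \in Li) = (existT (fun i : I => T i : Type) i s \in L)) /\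
    \sum_(s <- L | tag s == i) `|v s| `^ p = \sum_(s <- Li) `|v (existT (fun i : I => T i : Type) i s)| `^ p.
  elim: L uL => [|[j s] L IH] /=; first by exists [::]; rewrite ?big_nil.
  move=> /andP[sL /IH [Li ui [mi ei]]]; rewrite big_cons /= ei.
  case: eqVneq => [ji|ji].
    subst j; exists (s :: Li); first by rewrite /= mi sL.
    rewrite big_cons; split => // t; rewrite !inE mi; congr (_ || _).
    by rewrite -tag_eqE /tag_eq /= eqxx tagged_asE.
  exists Li => //; split => // t; rewrite mi inE.
  by rewrite -tag_eqE /tag_eq /= eq_sym (negbTE ji).
have -> : \sum_(s <- L) `|v s| `^ p =
    \sum_(i <- undup (map tag L)) \sum_(s <- L | tag s == i) `|v s| `^ p.
  rewrite (exchange_big_dep xpredT)//= big_seq [RHS]big_seq.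
  apply: eq_bigr => s sL.
  rewrite -big_filter (eq_filter (a2 := pred1 (tag s))); last first.
    by move=> i /=; rewrite eq_sym.
  by rewrite filter_pred1_uniq ?undup_uniq ?mem_undup ?map_f// big_seq1.
apply: le_trans (hb _ (undup_uniq _)).
apply: ler_sum => i _; have [Li ui [_ ->]] := split_i i.
by rewrite (ger0_norm (b0 i)); exact: hv.
Qed.

(** Summing over the values of [h] first, at most [M] coordinates lie over each [t], so the sum of
    the [p]-th powers is at most [M * C^p * B^p]; and [M <= M^p] as soon as [1 <= M]. *)
Lemma lple_fiber (S : choiceType) (v : S -> R) (h : S -> nat) (eta : nat -> R)
    (C B : R) (M : nat) :
  0 <= C -> 0 <= B -> (forall t, 0 <= eta t) ->
  (forall n, \sum_(t < n) eta t `^ p <= B `^ p) ->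
  (forall s, v s != 0 -> `|v s| <= C * eta (h s)) ->
  (forall t, exists2 l : seq S, (size l <= M)%N &
     forall s, v s != 0 -> h s = t -> s \in l) ->
  lple v (C * (M%:R * B)).
Proof.
move=> C0 B0 eta0 hB hv hf L uL.
have vanish s : v s = 0 -> `|v s| `^ p = 0.
  by move=> ->; rewrite normr0 powR0// gt_eqF.
rewrite (bigID (fun s => v s != 0))/= [X in _ + X]big1 ?addr0; last first.
  by move=> s /negPn /eqP /vanish.
have [M0|M0] := posnP M.
  rewrite big1 ?powR_ge0// => s vs.
  have [l] := hf (h s); rewrite M0 leqn0 size_eq0 => /eqP -> /(_ s vs erefl).
  by rewrite in_nil.
rewrite -big_filter; set L' := seq.filter _ L.
have uL' : uniq L' by rewrite filter_uniq.
have vL' s : s \in L' -> v s != 0 by rewrite mem_filter => /andP[].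
pose N := (\max_(s <- L') h s).+1.
have hN s : s \in L' -> (h s < N)%N.
  by move=> sL; rewrite /N ltnS; exact: leq_bigmax_seq.
apply: (@le_trans _ _ (\sum_(s <- L') \sum_(t < N | h s == t) (C * eta t) `^ p)).
  rewrite big_seq [leRHS]big_seq; apply: ler_sum => s sL.
  rewrite (bigD1 (Ordinal (hN s sL)))//= -[leLHS]addr0; apply: lerD.
    by apply: powR_ler => //; apply: hv; exact: vL'.
  by apply: sumr_ge0 => t _; exact: powR_ge0.
rewrite (exchange_big_dep xpredT)//=.
apply: (@le_trans _ _ (\sum_(t < N) M%:R * (C `^ p * eta t `^ p))).
  apply: ler_sum => t _; rewrite powRM//.
  rewrite -big_filter big_const_seq count_predT iter_addr addr0 -[leLHS]mulr_natl.
  apply: ler_wpM2r; first by apply: mulr_ge0; exact: powR_ge0.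
  rewrite ler_nat; have [l sl hl] := hf t; apply: leq_trans sl.
  apply: uniq_leq_size; first by rewrite filter_uniq.
  by move=> s; rewrite mem_filter => /andP[/eqP hs sL']; apply: hl => //; exact: vL'.
rewrite -mulr_sumr -mulr_sumr powRM//; last exact: mulr_ge0.
rewrite mulrCA; apply: ler_wpM2l; first exact: powR_ge0.
rewrite powRM//; apply: ler_pM => //; first by apply: sumr_ge0 => ? _; exact: powR_ge0.
have M1 : 1 <= M%:R :> R by rewrite ler1n.
rewrite -[leLHS]powRr1; last exact: le_trans M1.
by apply: ler_powR => //; exact: ltW.
Qed.

Lemma lple_lower (S : choiceType) (v : S -> R) (a beta : R) (N : nat)
    (c : nat -> S) :
  0 <= beta -> lple v a ->
  (forall k l, (k < N)%N -> (l < N)%N -> c k = c l -> k = l) ->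
  (forall k, (k < N)%N -> beta <= `|v (c k)|) ->
  N%:R * beta `^ p <= a `^ p.
Proof.
move=> b0 hv ci hb.
have := hv (map c (iota 0 N)).
rewrite map_inj_in_uniq ?iota_uniq; last first.
  by move=> k l; rewrite !mem_iota !add0n /= => kN lN; exact: ci.
move=> /(_ isT); apply: le_trans; rewrite big_map.
have -> : N%:R * beta `^ p = \sum_(k <- iota 0 N) beta `^ p.
  by rewrite big_const_seq count_predT iter_addr addr0 size_iota mulr_natl.
rewrite big_seq [leRHS]big_seq; apply: ler_sum => k; rewrite mem_iota add0n /= => kN.
by apply: powR_ler => //; exact: hb.
Qed.

(** The extended sum is the supremum of its finite subsums. This is the bridge from [lple] to
    [lp_mem] and [lpnorm]. *)
Lemma lple_esum (S : choiceType) (v : S -> R) (a : R) :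
  lple v a <-> (\esum_(s in [set: S]) ((`|v s| `^ p)%:E) <= (a `^ p)%:E)%E.
Proof.
split=> [hv|hv L uL].
  apply: ge_ereal_sup => _ [F [finF _] <-].
  rewrite fsbig_finite//= sumEFin lee_fin; apply: hv; exact: finmap.fset_uniq.
rewrite -lee_fin; apply: le_trans hv; apply: esum_ge.
exists [set` L]; first by split=> //; exact: finite_seq.
by rewrite -fsbig_seq// sumEFin.
Qed.

Lemma lple_lp_mem (S : choiceType) (v : S -> R) (a : R) : lple v a -> lp_mem p v.
Proof. by move=> /lple_esum h; apply: le_lt_trans h _; rewrite ltry. Qed.

Lemma lp_memP (S : choiceType) (v : S -> R) : lp_mem p v -> lple v (lpnorm p v).
Proof.
move=> hv; apply/lple_esum; rewrite /lpnorm -powRrM mulVf ?gt_eqF//.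
set E := (X in (X <= _)%E).
have E0 : (0 <= E)%E by apply: esum_ge0 => s _; rewrite lee_fin powR_ge0.
rewrite powRr1 ?fine_ge0// fineK//.
by rewrite ge0_fin_numE//; exact: hv.
Qed.

Lemma lpnorm_ge0 (S : choiceType) (v : S -> R) : 0 <= lpnorm p v.
Proof. exact: powR_ge0. Qed.

Lemma lpnorm_le (S : choiceType) (v : S -> R) (a : R) :
  0 <= a -> lple v a -> lpnorm p v <= a.
Proof.
move=> a0 hv; have hm := lple_lp_mem hv.
move/lple_esum: hv; rewrite /lp_mem /lpnorm in hm *.
set E := (X in (X <= _)%E) => hE.
have E0 : (0 <= E)%E by apply: esum_ge0 => s _; rewrite lee_fin powR_ge0.
apply: (powR_ler_inv hp1) => //; first exact: powR_ge0.
rewrite -powRrM mulVf ?gt_eqF// powRr1 ?fine_ge0//.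
by rewrite -lee_fin fineK// ge0_fin_numE.
Qed.

End Lple.

(** * The graph metric, balls and distances to sets *)

Section Graph.
Variables (X : choiceType) (adj : X -> X -> Prop).
Hypothesis adjS : forall x y, adj x y -> adj y x.
Hypothesis conn : forall x y, exists n, walk adj n x y.

Local Notation d := (gdist adj).

Lemma gdist_walk x y : walk adj (d x y) x y.
Proof.
rewrite /gdist; case: pselect => [h|/(_ (conn x y))//].
by case: ex_minnP => n /asboolP.
Qed.

Lemma gdist_le n x y : walk adj n x y -> (d x y <= n)%N.
Proof.
move=> hw; rewrite /gdist; case: pselect => [h|/(_ (conn x y))//].
by case: ex_minnP => m _; apply; apply/asboolP.
Qed.

Lemma gdistxx x : d x x = 0%N.
Proof.
apply/eqP; rewrite -leqn0; apply: gdist_le.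
by exists (fun _ => x); split=> //; split.
Qed.

Lemma gdist0_eq x y : d x y = 0%N -> x = y.
Proof. by move=> h; have := gdist_walk x y; rewrite h => -[w [-> []]]. Qed.

Lemma gdist_sym x y : d x y = d y x.
Proof.
have le a b : (d a b <= d b a)%N.
  have [w [w0 [wn wk]]] := gdist_walk b a.
  apply: gdist_le; exists (fun k => w (d b a - k)%N).
  rewrite subn0 subnn; split => //; split => // k kn.
  have -> : (d b a - k = (d b a - k.+1).+1)%N by lia.
  by apply: adjS; apply: wk; lia.
by apply/eqP; rewrite eqn_leq !le.
Qed.

Lemma walk_cat n m x y z :
  walk adj n x y -> walk adj m y z -> walk adj (n + m) x z.
Proof.
move=> [w [w0 [wn wk]]] [v [v0 [vm vk]]].
exists (fun k => if (k <= n)%N then w k else v (k - n)%N); split; first by rewrite leq0n.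
split.
  case: leqP => h; last by rewrite addKn.
  have m0 : m = 0%N by lia.
  by rewrite m0 addn0 wn -v0 -vm m0.
move=> k km; case: (ltngtP k n) => h.
- exact: wk.
- have -> : (k.+1 - n = (k - n).+1)%N by lia.
  by apply: vk; lia.
- by rewrite h subSnn wn -v0; apply: vk; lia.
Qed.

Lemma gdist_tri x y z : (d x z <= d x y + d y z)%N.
Proof. by apply: gdist_le; apply: walk_cat (gdist_walk _ _) (gdist_walk _ _). Qed.

Lemma walk1 x y : adj x y -> walk adj 1 x y.
Proof.
move=> h; exists (fun k => if k == 0%N then x else y).
by split=> //; split=> // -[|].
Qed.

Lemma gdist_adj x y : adj x y -> (d x y <= 1)%N.
Proof. by move=> /walk1 /gdist_le. Qed.

Lemma gdist_step n x y : d x y = n.+1 -> exists z, (d x z <= 1)%N /\ d z y = n.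
Proof.
move=> h; have := gdist_walk x y; rewrite h => -[w [w0 [wn wk]]].
exists (w 1%N).
have le1 : (d x (w 1%N) <= 1)%N by rewrite -w0; apply: gdist_adj; exact: wk.
split => //.
have le2 : (d (w 1%N) y <= n)%N.
  apply: gdist_le; exists (fun k => w k.+1); split=> //; split=> // k kn; exact: wk.
have := gdist_tri x (w 1%N) y; lia.
Qed.

Lemma gdist_stepr n x y : d x y = n.+1 -> exists z, adj z y /\ (d x z <= n)%N.
Proof.
move=> h; have := gdist_walk x y; rewrite h => -[w [w0 [wn wk]]].
exists (w n); split; first by rewrite -wn; exact: wk.
by apply: gdist_le; exists w; split=> //; split=> // k kn; apply: wk; lia.
Qed.

Lemma finite_balls D :
  (forall x, exists s : seq X, (forall y, adj x y -> y \in s) /\ (size s <= D)%N) ->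
  exists (bl : X -> nat -> seq X) (B : nat -> nat), forall x r,
    [/\ uniq (bl x r), (size (bl x r) <= B r)%N &
        forall y, (d x y <= r)%N -> y \in bl x r].
Proof.
move=> /choice [nb hnb].
pose bl x := fix bl r := if r is r'.+1 then
  undup (bl r' ++ flatten (map nb (bl r'))) else [:: x].
pose B := fix B r := if r is r'.+1 then (B r' + B r' * D)%N else 1%N.
have szf s : (size (flatten (map nb s)) <= size s * D)%N.
  elim: s => //= z s IH; rewrite size_cat mulSn leq_add//.
  by have [_] := hnb z.
exists bl, B => x; elim=> [|r [ur sr mr]].
  by split=> // y; rewrite leqn0 => /eqP /gdist0_eq ->; rewrite inE.
split=> [||y]; first exact: undup_uniq.
  rewrite /= (leq_trans (size_undup _))// size_cat leq_add//.
  by rewrite (leq_trans (szf _))// leq_mul2r sr orbT.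
rewrite leq_eqVlt ltnS /= mem_undup mem_cat => /orP[/eqP h|h]; last by rewrite mr.
have [z [zy xz]] := gdist_stepr h.
apply/orP; right; apply/flattenP; exists (nb z); first by rewrite map_f// mr.
by have [+ _] := hnb z; apply.
Qed.

(** Integer form of [dset]. The value 0 on the empty set agrees with the infimum of the empty set
    there. *)
Definition ndist (x : X) (P : set X) : nat :=
  match pselect (exists n, `[< exists2 y, P y & d x y = n >]) with
  | left h => ex_minn h
  | right _ => 0%N
  end.

Lemma ndistP x (P : set X) : P !=set0 ->
  (exists2 y, P y & d x y = ndist x P) /\ forall y, P y -> (ndist x P <= d x y)%N.
Proof.
move=> [a Pa]; rewrite /ndist; case: pselect => [h|[]]; last first.
  by exists (d x a); apply/asboolP; exists a.
case: ex_minnP => n /asboolP [y Py yn] mn; split; first by exists y.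
by move=> z Pz; apply: mn; apply/asboolP; exists z.
Qed.

Lemma ndist_set0 x (P : set X) : ~ (P !=set0) -> ndist x P = 0%N.
Proof.
move=> h; rewrite /ndist; case: pselect => // hn; exfalso; apply: h.
by case: hn => n /asboolP [y Py _]; exists y.
Qed.

Lemma ndist_lip x y (P : set X) : (ndist x P <= ndist y P + d x y)%N.
Proof.
have [P0|P0] := pselect (P !=set0); last by rewrite ndist_set0.
have [[z Pz <-] _] := ndistP y P0.
have [_ /(_ z Pz)] := ndistP x P0.
have := gdist_tri x y z; lia.
Qed.

(** * Tent functions *)

Section Tent.
Variable C0 : nat.

(** The test is needed because [ndist] is 0 on the empty set, which would produce a tent of full
    height instead of none. *)
Definition tent (x : X) (P : set X) (r : nat) : nat :=
  if `[< P !=set0 >] then (r.+1 - C0 * ndist x P)%N else 0%N.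

Lemma tent_le x P r : (tent x P r <= r.+1)%N.
Proof. by rewrite /tent; case: asboolP => // _; exact: leq_subr. Qed.

Lemma tent_ge x (P : set X) r y : P y -> (r.+1 - C0 * d x y <= tent x P r)%N.
Proof.
move=> Py; have P0 : P !=set0 by exists y.
rewrite /tent; case: asboolP => // _; apply: leq_sub2l; rewrite leq_mul2l.
by have [_ ->//] := ndistP x P0; rewrite orbT.
Qed.

Lemma tent_in x (P : set X) r : P x -> tent x P r = r.+1.
Proof.
move=> /(tent_ge x r); rewrite gdistxx muln0 subn0 => h.
by apply/eqP; rewrite eqn_leq h tent_le.
Qed.

Lemma tent_gt0 x (P : set X) r : (0 < tent x P r)%N ->
  exists y, [/\ P y, (C0 * d x y <= r)%N & tent x P r = (r.+1 - C0 * d x y)%N].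
Proof.
rewrite /tent; case: asboolP => // P0; rewrite subn_gt0 ltnS => h.
by have [[y Py yd] _] := ndistP x P0; exists y; rewrite yd.
Qed.

Lemma tent_lip x y (P : set X) r r' : (d x y <= 1)%N -> (r' <= r.+1)%N ->
  (tent y P r' <= tent x P r + C0.+1)%N.
Proof.
move=> xy rr; rewrite /tent; case: asboolP => // P0.
have h := ndist_lip x y P.
have : (C0 * ndist x P <= C0 * (ndist y P).+1)%N.
  by rewrite leq_mul2l; apply/orP; right; lia.
rewrite mulnS; lia.
Qed.

End Tent.

Lemma dset_ndist (R : realType) x (P : set X) : P !=set0 ->
  dset (R := R) adj x P = (ndist x P)%:R.
Proof.
move=> P0; have [[z Pz zd] mn] := ndistP x P0.
apply/eqP; rewrite eq_le; apply/andP; split.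
  apply: ge_inf; last by exists z => //; rewrite zd.
  by exists 0; move=> y [a _ <-].
apply: lb_le_inf; first by exists (d x z)%:R; exists z.
by move=> y [a Pa <-]; rewrite ler_nat mn.
Qed.

Lemma dset_set0 (R : realType) x (P : set X) : ~ (P !=set0) ->
  dset (R := R) adj x P = 0.
Proof.
move=> P0; rewrite /dset (_ : [set _ | _ in P] = set0) ?inf0//.
apply/seteqP; split => // y [a Pa _]; exfalso; apply: P0; by exists a.
Qed.

(** * Geodesics and their domains *)

Section Geodesics.
Variable e : X.

(** Each of the three subwalks cut out by [a] and [b] bounds a distance from above. Their lengths
    add up to the distance from the start to [e], so no bound can be strict. *)
Lemma geod_dist (g : geo X) a b : is_geod adj e g -> (a <= b)%N -> (b <= g.1)%N ->
  d (g.2 a) (g.2 b) = (b - a)%N.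
Proof.
case: g => n g /= [gn [nd gk]] ab bn.
have up i j : (i <= j)%N -> (j <= n)%N -> (d (g i) (g j) <= j - i)%N.
  move=> ij jn; apply: gdist_le; exists (fun k => g (i + k)%N).
  rewrite addn0 subnKC//; split=> //; split=> // k kj.
  by rewrite addnS; apply: gk; lia.
have h1 := up 0%N a (leq0n _) (leq_trans ab bn).
have h2 := up a b ab bn.
have h3 := up b n bn (leqnn _).
have h4 := gdist_tri (g 0%N) (g a) e.
have h5 := gdist_tri (g a) (g b) e.
rewrite gn in h3; lia.
Qed.

Lemma geod_end (g : geo X) k : is_geod adj e g -> (k <= g.1)%N ->
  d (g.2 k) e = (g.1 - k)%N.
Proof.
move=> hg kn; have ge : g.2 g.1 = e by case: g hg {kn} => n g [].
by rewrite -[X in d _ X]ge; apply: geod_dist.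
Qed.

Lemma geod_len (g : geo X) : is_geod adj e g -> g.1 = d (gstart g) e.
Proof. by case: g => n g [_ []]. Qed.

(** Tails cut at consecutive indices start at adjacent vertices, which allows (C2) to be applied
    along a single geodesic. *)
Lemma geod_tail (g : geo X) k : is_geod adj e g -> (k <= g.1)%N ->
  is_geod adj e ((g.1 - k)%N, fun j => g.2 (k + j)%N).
Proof.
move=> hg kn; have hk := geod_end hg kn; move: hg kn hk.
case: g => n g /= [gn [nd gk]] kn hk; split; first by rewrite subnKC.
split; first by rewrite addn0 hk.
by move=> j jn; rewrite addnS; apply: gk; lia.
Qed.

Lemma geod_ex x : exists g : geo X, is_geod adj e g /\ gstart g = x.
Proof.
have [w [w0 [wn wk]]] := gdist_walk x e.
by exists (d x e, w); rewrite /gstart /= w0.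
Qed.

Section Domain.
Variables (g : geo X) (A : set X).

Lemma kmin_le k : (k <= g.1)%N -> A (g.2 k) -> (kmin g A <= k)%N.
Proof.
move=> kn /asboolP Ak; rewrite /kmin.
have := mem_index_enum (Ordinal (kn : k < g.1.+1)%N).
elim: index_enum => // i s IH; rewrite inE big_cons => /orP[/eqP <-|/IH h].
  by rewrite Ak; exact: geq_minl.
by case: ifP => // _; apply: leq_trans h; exact: geq_minr.
Qed.

Lemma kmax_ge k : (k <= g.1)%N -> A (g.2 k) -> (k <= kmax g A)%N.
Proof.
move=> kn /asboolP Ak; rewrite /kmax.
exact: (@leq_bigmax_cond _ _ (fun i : 'I_g.1.+1 => i : nat) (Ordinal (kn : k < g.1.+1)%N)).
Qed.

Lemma kmin_spec : meets g A -> (kmin g A <= g.1)%N /\ A (g.2 (kmin g A)).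
Proof.
move=> [k [kn Ak]].
(* The second alternative fails only when the default [g.1] of the minimum survives; then the given
   hit [k] must be [g.1] itself. *)
have : (kmin g A <= g.1)%N /\ ((kmin g A = g.1) \/ A (g.2 (kmin g A))).
  rewrite /kmin; apply: (big_ind (fun m => (m <= g.1)%N /\ (m = g.1 \/ A (g.2 m)))).
  - by split=> //; left.
  - by move=> a b [la ha] [lb hb]; rewrite /minn; case: ltnP.
  - by move=> i /asboolP Ai; split; [rewrite -ltnS; exact: ltn_ord|right].
move=> [le []// b]; split=> //.
by have := kmin_le kn Ak; rewrite b => gk; have -> : g.1 = k by lia.
Qed.

Lemma kmax_spec : meets g A -> (kmax g A <= g.1)%N /\ A (g.2 (kmax g A)).
Proof.
move=> [k [kn Ak]].
have : (kmax g A <= g.1)%N /\ ((kmax g A = 0)%N \/ A (g.2 (kmax g A))).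
  rewrite /kmax; apply: (big_ind (fun m => (m <= g.1)%N /\ ((m = 0)%N \/ A (g.2 m)))).
  - by split=> //; left.
  - by move=> a b [la ha] [lb hb]; rewrite /maxn; case: ltnP.
  - by move=> i /asboolP Ai; split; [rewrite -ltnS; exact: ltn_ord|right].
move=> [le []// b]; split=> //.
by have := kmax_ge kn Ak; rewrite b leqn0 => /eqP <-.
Qed.

Lemma kmin_kmax : meets g A -> (kmin g A <= kmax g A)%N.
Proof. by move=> /kmin_spec [le Am]; exact: kmax_ge. Qed.

End Domain.

End Geodesics.
End Graph.

(** * Projections of geodesics to the pieces *)

Section Coarse.
Variables (X : choiceType) (adj : X -> X -> Prop).
Hypothesis adjS : forall x y, adj x y -> adj y x.
Hypothesis conn : forall x y, exists n, walk adj n x y.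
Variables (e : X) (I : choiceType) (A : I -> set X) (kap : nat).

Local Notation d := (gdist adj).
Local Notation geod := (is_geod adj e).

Hypothesis C1 : forall i g h, geod g -> geod h -> meets g (A i) -> meets h (A i) ->
  (d (dminus g (A i)) (dminus h (A i)) <= kap)%N.
Hypothesis C2 : forall i g h, geod g -> geod h ->
  (d (gstart g) (gstart h) <= 1)%N \/
    (4 * d (gstart g) (gstart h) <= ndist adj (gstart g) (A i))%N ->
  (meets g (A i) -> meets h (A i) -> (d (dplus g (A i)) (dplus h (A i)) <= kap)%N) /\
  (meets g (A i) -> ~ meets h (A i) -> (ilen adj g (A i) <= kap)%N).

Let dxx := gdistxx conn.
Let dsym := gdist_sym adjS conn.
Let dtri := gdist_tri conn.

Lemma domain_facts g i : geod g -> meets g (A i) ->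
  [/\ (kmin g (A i) <= kmax g (A i))%N, (kmax g (A i) <= g.1)%N,
      g.1 = d (gstart g) e, A i (dplus g (A i)) & A i (dminus g (A i))] /\
  [/\ d (gstart g) (dplus g (A i)) = kmin g (A i),
      d (dplus g (A i)) e = (g.1 - kmin g (A i))%N,
      d (dminus g (A i)) e = (g.1 - kmax g (A i))%N,
      d (dplus g (A i)) (dminus g (A i)) = (kmax g (A i) - kmin g (A i))%N &
      ilen adj g (A i) = (kmax g (A i) - kmin g (A i)).+1].
Proof.
move=> hg hm; have [m1 m2] := kmin_spec hm; have [n1 n2] := kmax_spec hm.
have mn := kmin_kmax hm.
split; first by split=> //; exact: geod_len hg.
have eq1 := geod_dist conn hg mn n1.
split=> //.
- by rewrite /gstart /dplus (geod_dist conn hg)// subn0.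
- exact: (geod_end conn hg).
- exact: (geod_end conn hg).
- by rewrite /ilen dsym eq1.
Qed.

(** By (C1) the exit of any one geodesic serves for all. The default [e] concerns only pieces that
    no geodesic meets, that is, empty ones. *)
Lemma exits_ex : exists q : I -> X, forall i g, geod g -> meets g (A i) ->
  (d (dminus g (A i)) (q i) <= kap)%N /\ A i (q i).
Proof.
suff /choice [q hq] : forall i, exists z, forall g, geod g -> meets g (A i) ->
    (d (dminus g (A i)) z <= kap)%N /\ A i z by exists q.
move=> i; have [[h [hh mh]]|no] := pselect (exists h, geod h /\ meets h (A i)).
  exists (dminus h (A i)) => g hg mg; split; first exact: C1.
  by have [[]] := domain_facts hh mh.
by exists e => g hg mg; exfalso; apply: no; exists g.
Qed.

Variable q : I -> X.
Hypothesis hq : forall i g, geod g -> meets g (A i) ->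
  (d (dminus g (A i)) (q i) <= kap)%N /\ A i (q i).

Definition proj (g : geo X) (i : I) : X :=
  if `[< meets g (A i) >] then dplus g (A i) else q i.

Lemma proj_meets g i : meets g (A i) -> proj g i = dplus g (A i).
Proof. by move=> h; rewrite /proj; case: asboolP. Qed.

Lemma proj_nmeets g i : ~ meets g (A i) -> proj g i = q i.
Proof. by move=> h; rewrite /proj; case: asboolP. Qed.

(** A geodesic that starts in the piece meets it, so a nonempty piece contains its common exit
    [q i]. *)
Lemma proj_A g i : geod g -> A i !=set0 -> A i (proj g i) /\ A i (q i).
Proof.
move=> hg [a Aa].
have [h [hh ha]] := geod_ex conn e a.
have [_ qA] : (d (dminus h (A i)) (q i) <= kap)%N /\ A i (q i).
  by apply: hq => //; exists 0%N; split=> //; move: ha; rewrite /gstart => ->.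
have [mg|mg] := pselect (meets g (A i)); last by rewrite proj_nmeets.
by rewrite proj_meets//; have [[]] := domain_facts hg mg.
Qed.

(* Short domains end near the common exit, so [q i] is a consistent value for
   the projection of the geodesics that miss [A i]. *)
Lemma proj_near g h i : geod g -> geod h ->
  (d (gstart g) (gstart h) <= 1)%N \/
    (5 * d (gstart g) (gstart h) <= ndist adj (gstart g) (A i))%N ->
  (d (proj g i) (proj h i) <= 2 * kap)%N.
Proof.
move=> hg hh hd.
have lip := ndist_lip conn (gstart g) (gstart h) (A i).
have [mg|mg] := pselect (meets g (A i)); have [mh|mh] := pselect (meets h (A i)).
- rewrite !proj_meets//.
  have [c _] := C2 (i := i) hg hh ltac:(lia).
  by have := c mg mh; lia.
- rewrite proj_meets// proj_nmeets//.
  have [_ c] := C2 (i := i) hg hh ltac:(lia).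
  have := c mg mh; have [_ [_ _ _ h1 h2]] := domain_facts hg mg.
  have [h3 _] := hq hg mg.
  have := dtri (dplus g (A i)) (dminus g (A i)) (q i); lia.
- rewrite proj_nmeets// proj_meets//.
  (* The roles of [g] and [h] are exchanged: moving the base point costs one unit of distance, which
     turns the factor 5 into the factor 4 of (C2). *)
  have hd' : (d (gstart h) (gstart g) <= 1)%N \/
    (4 * d (gstart h) (gstart g) <= ndist adj (gstart h) (A i))%N.
    by rewrite (dsym (gstart h)); lia.
  have [_ c] := C2 (i := i) hh hg hd'.
  have := c mh mg; have [_ [_ _ _ h1 h2]] := domain_facts hh mh.
  have [h3 _] := hq hh mh.
  have := dtri (dplus h (A i)) (dminus h (A i)) (q i).
  rewrite (dsym (q i) (dplus h (A i))); lia.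
- by rewrite !proj_nmeets// dxx.
Qed.

(** Chain [proj_near] along a shortest path between the starting points. The bound at [n = 0] is
    positive since two geodesics from one vertex may project differently. *)
Lemma proj_lip n g h i : geod g -> geod h -> (d (gstart g) (gstart h) <= n)%N ->
  (d (proj g i) (proj h i) <= 2 * kap * n.+1)%N.
Proof.
elim: n g => [|n IH] g hg hh hd.
  by rewrite muln1; apply: proj_near => //; left; lia.
have [le|gt] := leqP (d (gstart g) (gstart h)) n.
  by apply: leq_trans (IH _ hg hh le) _; rewrite leq_mul2l; lia.
have eqn : d (gstart g) (gstart h) = n.+1 by lia.
have [z [z1 zn]] := gdist_step conn eqn.
have [f [hf fz]] := geod_ex conn e z.
rewrite -fz in z1 zn.
have h1 := proj_near (i := i) hg hf (or_introl z1).
have h2 : (d (proj f i) (proj h i) <= 2 * kap * n.+1)%N by apply: IH => //; rewrite zn.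
have := dtri (proj g i) (proj f i) (proj h i).
rewrite mulnS; lia.
Qed.

(** Cost of one step towards a piece: the step itself and a move of the projection by at most
    [2 * kap]. *)
Definition lam := (2 * kap).+1.

(** Walk towards a nearest point of the piece, paying [lam] per step. On arrival the starting point
    is its own entry point. *)
Lemma proj_dist r g i : geod g -> A i !=set0 -> (ndist adj (gstart g) (A i) <= r)%N ->
  (d (gstart g) (proj g i) <= lam * r)%N.
Proof.
move=> + A0; elim: r g => [|r IH] g hg hr.
  have [[a Aa ad] _] := ndistP adj (gstart g) A0.
  have ga : gstart g = a by apply: (gdist0_eq conn); lia.
  have mg : meets g (A i) by exists 0%N; split=> //; rewrite -/(gstart g) ga.
  have km : (kmin g (A i) <= 0)%N by apply: kmin_le => //; rewrite -/(gstart g) ga.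
  have [_ [h1 _ _ _ _]] := domain_facts hg mg.
  by rewrite proj_meets// h1; lia.
have [le|gt] := leqP (ndist adj (gstart g) (A i)) r.
  by apply: leq_trans (IH _ hg le) _; rewrite leq_mul2l; lia.
have [[a Aa ad] _] := ndistP adj (gstart g) A0.
have eqn : d (gstart g) a = r.+1 by lia.
have [z [z1 zn]] := gdist_step conn eqn.
have [f [hf fz]] := geod_ex conn e z.
rewrite -fz in z1 zn.
have h1 := proj_near (i := i) hg hf (or_introl z1).
have hz : (ndist adj (gstart f) (A i) <= r)%N.
  by have [_ /(_ a Aa)] := ndistP adj (gstart f) A0; rewrite zn.
have h2 := IH f hf hz.
have := dtri (gstart g) (gstart f) (proj g i).
have := dtri (gstart f) (proj f i) (proj g i).
rewrite (dsym (proj f i)) /lam in h1 h2 *; rewrite mulnS; lia.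
Qed.

Lemma entry_dist g i : geod g -> meets g (A i) ->
  (ndist adj (gstart g) (A i) <= kmin g (A i))%N /\
  (kmin g (A i) <= lam * ndist adj (gstart g) (A i))%N.
Proof.
move=> hg mg; have [[_ _ _ Az _] [sz _ _ _ _]] := domain_facts hg mg.
have A0 : A i !=set0 by exists (dplus g (A i)).
split.
  by have [_ /(_ _ Az)] := ndistP adj (gstart g) A0; rewrite sz.
by have := proj_dist hg A0 (leqnn _); rewrite proj_meets// sz.
Qed.

(* Two consecutive vertices have entry points at distance at most [kap], so the
   gaps of [A i] along a domain have length at most [kap]. *)
Lemma domain_close g i k : geod g -> meets g (A i) ->
  (kmin g (A i) <= k)%N -> (k <= kmax g (A i))%N ->
  exists2 w, A i w & (d (g.2 k) w <= kap)%N.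
Proof.
move=> hg mg mk kM.
have [[_ Mn _ Az Am] _] := domain_facts hg mg.
have kn : (k <= g.1)%N by lia.
pose P j := (j <= k)%N && `[< A i (g.2 j) >].
have P0 : exists j, P j by exists (kmin g (A i)); rewrite /P mk; apply/asboolP.
have Pk j : P j -> (j <= k)%N by move=> /andP[].
case: (ex_maxnP P0 Pk) => j /andP[jk /asboolP Aj] jmax.
have [<-|jk'] := eqVneq j k; first by exists (g.2 j); rewrite ?dxx.
have {jk'}jk : (j < k)%N by lia.
have h1 := geod_tail conn hg (ltnW (leq_trans jk kn)).
have h2 := geod_tail conn hg (leq_trans jk kn).
set f1 : geo X := (_, _) in h1; set f2 : geo X := (_, _) in h2.
(* The tail from [j] enters the piece at once and the tail from [j.+1] at the next visit, so (C2)
   bounds the gap around [k]. *)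
have m1 : meets f1 (A i) by exists 0%N; rewrite /= addn0.
have m2 : meets f2 (A i).
  exists (kmax g (A i) - j.+1)%N; rewrite /=; split; first lia.
  by rewrite addSn -addnS -subSn ?subSS; [rewrite subnKC//; lia|lia].
have k1 : kmin f1 (A i) = 0%N.
  by apply/eqP; rewrite -leqn0; apply: kmin_le => //=; rewrite addn0.
have [l2 a2] := kmin_spec m2; rewrite /= in l2 a2.
have st : (d (gstart f1) (gstart f2) <= 1)%N.
  rewrite /gstart /= !addn0 (geod_dist conn hg); lia.
have [c _] := C2 (i := i) h1 h2 (or_introl st).
have := c m1 m2; rewrite /dplus k1 /= addn0.
rewrite (geod_dist conn hg); [|lia|lia] => le.
exists (g.2 (j.+1 + kmin f2 (A i))%N) => //.
have gt : (k < j.+1 + kmin f2 (A i))%N.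
  rewrite ltnNge; apply/negP => le'.
  have /jmax : P (j.+1 + kmin f2 (A i))%N by rewrite /P le'; apply/asboolP.
  lia.
rewrite (geod_dist conn hg); lia.
Qed.

(** The slope of all tents. It exceeds the factors 4 of [bdryx] and 5 of [proj_near]; the size 20
    absorbs the errors, linear in the distance of starting points, in [excluded_covered] and
    [far_entry]. *)
Definition tent_cst := (20 * kap + 20)%N.

(* An entry point that the K-boundary excludes lies in a domain of [g] itself that
   is long enough to be seen by the long-piece field. *)
Lemma excluded_covered g h i j : geod g -> geod h -> meets g (A i) -> meets h (A j) ->
  (tent_cst * d (gstart g) (gstart h) <= ndist adj (gstart g) (A i))%N ->
  (kap < ilen adj h (A j))%N ->
  (d e (dminus h (A j)) + 2 * kap <= d e (dplus g (A i)))%N ->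
  (d e (dplus g (A i)) + 2 * kap <= d e (dplus h (A j)))%N ->
  [/\ meets g (A j), (kmin g (A j) <= kmin g (A i))%N,
     (kmin g (A i) <= kmax g (A j))%N & (kap < ilen adj g (A j))%N].
Proof.
move=> hg hh mg mh hb il ex1 ex2.
have [[gi1 gi2 gi3 _ _] [gi4 gi5 _ _ _]] := domain_facts hg mg.
have [[hj1 hj2 hj3 _ _] [hj4 hj5 hj6 hj7 hj8]] := domain_facts hh mh.
have [hr1 _] := entry_dist hg mg.
have [_ hr2] := entry_dist hh mh.
rewrite !(dsym e) in ex1 ex2.
have t1 := dtri (gstart g) (gstart h) e.
have t2 := dtri (gstart h) (gstart g) e.
rewrite (dsym (gstart h) (gstart g)) in t2.
have C1' := fun mgj => C1 hh hg mh mgj.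
set b := d (gstart g) (gstart h) in hb t1 t2 *.
(* Where (C2) compares [g] and [h] at [A j], entry and exit move by at most [kap], within the margin
   [2 * kap] of the exclusion. *)
have [small|big] := boolP ((b <= 1) || (4 * b <= ndist adj (gstart h) (A j)))%N.
  have hd : (d (gstart h) (gstart g) <= 1)%N \/
    (4 * d (gstart h) (gstart g) <= ndist adj (gstart h) (A j))%N.
    by rewrite (dsym (gstart h)) -/b; case/orP: small; [left|right].
  have [c c'] := C2 hh hg hd.
  have mgj : meets g (A j).
    by apply: contrapT => /(c' mh); lia.
  have cc := c mh mgj; have cm := C1' mgj.
  have [[gj1 gj2 _ _ _] [_ gj5 gj6 gj7 gj8]] := domain_facts hg mgj.
  have u1 := dtri (dplus h (A j)) (dplus g (A j)) e.
  have u2 := dtri (dminus g (A j)) (dminus h (A j)) e.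
  rewrite (dsym (dminus g (A j)) (dminus h (A j))) in u2.
  by split=> //; lia.
(* Otherwise [h] starts close to [A j] and enters it early, whereas the slope of the tents makes [g]
   enter [A i] late. The domain therefore has to stretch past the entry into [A i], and [g] cannot
   miss [A j]. *)
have [b1 b4] : (1 < b)%N /\ (ndist adj (gstart h) (A j) < 4 * b)%N by lia.
have lipj := proj_lip j hh hg (leqnn _).
rewrite (dsym (gstart h)) -/b (proj_meets mh) in lipj.
have lamb : (kmin h (A j) <= lam * (4 * b))%N.
  by apply: leq_trans hr2 _; rewrite leq_mul2l; apply/orP; right; lia.
have [exq _] := hq hh mh.
have kb : (kap <= kap * b)%N by apply: leq_pmulr; lia.
have Kb : (2 * kap * b.+1 = 2 * (kap * b) + 2 * kap)%N by lia.
have Lb : (lam * (4 * b) = 8 * (kap * b) + 4 * b)%N by rewrite /lam; lia.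
have Cb : (tent_cst * b = 20 * (kap * b) + 20 * b)%N by rewrite /tent_cst; lia.
have mgj : meets g (A j).
  apply: contrapT => ngj; rewrite (proj_nmeets ngj) in lipj.
  have u := dtri (dplus h (A j)) (q j) (dminus h (A j)).
  rewrite (dsym (q j)) in u.
  have u1 := dtri (dplus h (A j)) (dminus h (A j)) e.
  lia.
rewrite (proj_meets mgj) in lipj.
have cm := C1' mgj.
have [[gj1 gj2 _ _ _] [gj4 gj5 gj6 gj7 gj8]] := domain_facts hg mgj.
have u2 := dtri (dminus g (A j)) (dminus h (A j)) e.
rewrite (dsym (dminus g (A j)) (dminus h (A j))) in u2.
have u3 := dtri (gstart g) (gstart h) (dplus g (A j)).
have u4 := dtri (gstart h) (dplus h (A j)) (dplus g (A j)).
by split=> //; lia.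
Qed.

Section Lists.
Hypothesis C3 : forall x, exists2 l : seq I, (size l <= kap)%N & forall i, A i x -> i \in l.
Variables (bl : X -> nat -> seq X) (B : nat -> nat).
Hypothesis hbl : forall x r, [/\ uniq (bl x r), (size (bl x r) <= B r)%N &
        forall y, (d x y <= r)%N -> y \in bl x r].

Lemma pieces_near v r : exists2 l : seq I, (size l <= B r * kap)%N &
  forall i w, A i w -> (d v w <= r)%N -> i \in l.
Proof.
have /choice [f hf] : forall x, exists l : seq I,
    (size l <= kap)%N /\ forall i, A i x -> i \in l.
  by move=> x; have [l] := C3 x; exists l.
exists (flatten (map f (bl v r))).
  have [_ sz _] := hbl v r.
  apply: (@leq_trans (size (bl v r) * kap)); last by rewrite leq_mul2r sz orbT.
  elim: (bl v r) => //= z s IH; rewrite size_cat mulSn leq_add//.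
  by have [] := hf z.
move=> i w Aw vw; apply/flattenP; exists (f w); last by have [_] := hf w; apply.
by apply: map_f; have [_ _] := hbl v r; apply.
Qed.

End Lists.
End Coarse.

(** * The weight attached to a function with (C_p^c) *)

Section Weight.
Variables (R : realType) (p : R).
Hypothesis hp : 1 < p.
Variable f : nat -> R.
Hypothesis f0 : forall n, 0 <= f n.
Hypothesis hf : Cpc p f.

Let p0 : 0 < p. Proof. exact: lt_trans hp. Qed.
Let hp1 : 1 <= p. Proof. exact: ltW. Qed.

Lemma concave_double n : f (n + n)%N <= 2 * f n.
Proof.
have [[_ cf] _] := hf; have := cf n n (leqnn _); rewrite subnn.
have := f0 0%N; lra.
Qed.

(** The increments of a concave function do not increase, so the next one is at most each of the [n]
    increments that make up [f n - f 0]. *)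
Lemma concave_incr n : n%:R * (f n.+1 - f n) <= f n.
Proof.
have [[_ cf] _] := hf.
elim: n => [|n IH]; first by rewrite mul0r.
have := cf n.+1 1%N isT; rewrite addn1 subn1 /= => h.
have : n.+1%:R * (f n.+2 - f n.+1) <= n.+1%:R * (f n.+1 - f n).
  by apply: ler_wpM2l.
rewrite -[X in _ <= X * _ -> _]natr1 mulrDl mul1r; lra.
Qed.

Lemma concave_slope n : (0 < n)%N -> f n.+1 / n.+1%:R <= f n / n%:R.
Proof.
move=> n0; have nR : 0 < n%:R :> R by rewrite ltr0n.
rewrite ler_pdivrMr ?ltr0n// mulrAC ler_pdivlMr// -natr1 mulrDr mulr1.
have := concave_incr n; rewrite mulrBr; lra.
Qed.

Let root (m : nat) : R := m%:R `^ p^-1.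

Let rootp m : root m `^ p = m%:R.
Proof. by rewrite /root -powRrM mulVf ?gt_eqF// powRr1. Qed.

Let root_gt0 m : (0 < m)%N -> 0 < root m.
Proof. by move=> m0; rewrite powR_gt0// ltr0n. Qed.

Let root_le m n : (m <= n)%N -> root m <= root n.
Proof.
move=> mn; apply: ge0_ler_powR; rewrite ?nnegrE ?ler0n ?ler_nat//.
by rewrite invr_ge0 ltW.
Qed.

Let invp (x : R) : 0 <= x -> x^-1 `^ p = (x `^ p)^-1.
Proof. by move=> x0; rewrite -powR_inv1// -powRrM mulN1r powRN. Qed.

(* [eta] is [f(n) / n^(1+1/p)], frozen below a threshold: the summability of
   [eta^p] is the one in (C_p^c), and [n * eta n] is non-decreasing. *)
Lemma weight_ex n1 : 0 < f n1 -> exists (eta : nat -> R) (N0 : nat) (B c0 : R),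
  [/\ forall t, 0 < eta t, forall r, eta r.+1 <= eta r,
      forall r, (eta r - eta r.+1) * r.+1%:R <= 2 * eta r.+1,
      0 <= B & forall n, \sum_(t < n) eta t `^ p <= B `^ p] /\
  [/\ 0 < c0, forall r, c0 <= eta r * r.+1%:R &
      forall b r, (N0 <= b)%N -> (b <= r)%N -> f b `^ p <= b%:R * (eta r * r%:R) `^ p].
Proof.
move=> fn1; have [[fmono _] [fsum [n2 fn2]]] := hf.
(* From [n1] on [f] is positive, from [n2] on [f(n)^p / n] is non-decreasing, and 1 avoids dividing
   by zero. *)
pose N0 := maxn 1 (maxn n1 n2).
pose m t := maxn t N0.
pose eta t : R := f (m t) / (m t)%:R / root (m t).
have m0 t : (0 < m t)%N by rewrite /m /N0; lia.
have mR t : 0 < (m t)%:R :> R by rewrite ltr0n.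
have fm t : 0 < f (m t) by apply: lt_le_trans fn1 _; apply: fmono; rewrite /m /N0; lia.
have eta0 t : 0 < eta t.
  by rewrite /eta; apply: divr_gt0; [exact: divr_gt0|exact: root_gt0].
have etap t : eta t `^ p = (m t)%:R^-1 * (f (m t) / (m t)%:R) `^ p.
  rewrite /eta powRM ?divr_ge0 ?invr_ge0 ?powR_ge0//.
  by rewrite invp ?powR_ge0// rootp mulrC.
pose w t := eta t * (m t)%:R.
have wE t : w t = f (m t) / root (m t).
  by rewrite /w /eta; field; rewrite !gt_eqF ?root_gt0.
have w0 t : 0 < w t by rewrite /w mulr_gt0.
have wp t : w t `^ p = f (m t) `^ p / (m t)%:R.
  rewrite wE powRM ?invr_ge0 ?powR_ge0//.
  by rewrite invp ?powR_ge0// rootp.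
have wmono s t : (s <= t)%N -> w s <= w t.
  move=> st; apply: (powR_ler_inv hp1); rewrite ?(ltW (w0 _))// !wp.
  by apply: fn2; rewrite /m /N0; lia.
have mS t : m t.+1 = m t \/ (m t = t /\ m t.+1 = t.+1) by rewrite /m; lia.
have eta1 r : eta r.+1 <= eta r.
  rewrite /eta; have [->//|[er er1]] := mS r.
  rewrite er er1; have r0 : (0 < r)%N by rewrite -er.
  apply: ler_pM.
  - by apply: divr_ge0.
  - by rewrite invr_ge0 powR_ge0.
  - exact: concave_slope.
  - by rewrite lef_pV2 ?posrE ?root_gt0// root_le.
exists eta, N0.
pose E : \bar R := \esum_(n in [set n : nat | (0 < n)%N])
      (((n%:R)^-1 * (f n / n%:R) `^ p)%:E).
have E0 : (0 <= E)%E.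
  by apply: esum_ge0 => n _; rewrite lee_fin mulr_ge0 ?powR_ge0// invr_ge0.
(* The first summand pays for the terms below [N0], the second for the others, which are terms of
   the series in (C_p^c). *)
pose B := (N0%:R * eta 0 `^ p + fine E) `^ p^-1.
have BE : B `^ p = N0%:R * eta 0 `^ p + fine E.
  by rewrite /B -powRrM mulVf ?gt_eqF// powRr1// addr_ge0 ?mulr_ge0 ?powR_ge0// fine_ge0.
exists B, (w 0 / N0%:R).
have N0R : 0 < N0%:R :> R by rewrite ltr0n /N0; lia.
split; split=> //.
(* As [w] is non-decreasing and [m] grows by at most 1, [(eta r - eta r.+1) * m r] is at most
   [eta r.+1]; moreover [r.+1 <= 2 * m r]. *)
- move=> r.
  have d0 : 0 <= eta r - eta r.+1 by rewrite subr_ge0.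
  have h1 : r.+1%:R <= 2 * (m r)%:R :> R.
    by rewrite -natrM ler_nat; have := m0 r; rewrite /m; lia.
  have h2 : w r <= w r.+1 by apply: wmono.
  have h3 : (m r.+1)%:R <= (m r)%:R + 1 :> R.
    by rewrite natr1 ler_nat; have [->|[-> ->]] := mS r.
  have h4 : (eta r - eta r.+1) * r.+1%:R <= (eta r - eta r.+1) * (2 * (m r)%:R).
    exact: ler_wpM2l.
  have h5 : eta r.+1 * (m r.+1)%:R <= eta r.+1 * ((m r)%:R + 1).
    by apply: ler_wpM2l => //; exact: ltW.
  rewrite /w in h2; rewrite mulrDr mulr1 in h5; apply: le_trans h4 _.
  rewrite mulrCA mulrBl; lra.
- exact: powR_ge0.
- move=> n; rewrite BE.
  have -> : \sum_(t < n) eta t `^ p = \sum_(0 <= t < n) eta t `^ p by rewrite big_mkord.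
  rewrite (bigID (fun t => (t < N0)%N))/=; apply: lerD.
    apply: (@le_trans _ _ (\sum_(0 <= t < N0) eta 0 `^ p)).
      apply: (@le_trans _ _ (\sum_(0 <= t < n | (t < N0)%N) eta 0 `^ p)).
        apply: ler_sum => t tN; apply: powR_ler => //; first exact: ltW.
        elim: t {tN} => // t IH; exact: le_trans IH.
      rewrite -big_filter !big_const_seq !count_predT !iter_addr !addr0.
      rewrite -![eta 0%N `^ p *+ _]mulr_natl; apply: ler_wpM2r; first exact: powR_ge0.
      rewrite ler_nat.
      apply: uniq_leq_size; first by rewrite filter_uniq// iota_uniq.
      by move=> t; rewrite mem_filter !mem_index_iota => /andP[].
    by rewrite big_const_seq count_predT iter_addr addr0 size_iota subn0 mulr_natl.
  rewrite -lee_fin fineK ?ge0_fin_numE// -big_filter -sumEFin.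
  apply: esum_ge.
  exists [set` [seq t <- index_iota 0 n | ~~ (t < N0)%N]].
    split; first exact: finite_seq.
    by move=> t /=; rewrite mem_filter => /andP[+ _]; rewrite /N0; lia.
  rewrite -fsbig_seq ?filter_uniq ?iota_uniq//.
  rewrite big_seq [leRHS]big_seq; apply: lee_sum => t.
  rewrite mem_filter => /andP[tN _]; rewrite etap.
  by have -> : m t = t by rewrite /m; lia.
- exact: divr_gt0.
(* The choice [c0 = w 0 / N0] works because [w 0 <= w r] and [m r <= N0 * r.+1]. *)
- move=> r; rewrite ler_pdivrMr//; apply: (le_trans (wmono 0%N r _)) => //.
  rewrite {1}/w -[leRHS]mulrA; apply: ler_wpM2l; first exact: ltW.
  by rewrite -natrM ler_nat /m /N0; nia.
- move=> b r Nb br; have b0 : (0 < b)%N by move: Nb; rewrite /N0; lia.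
  have h s : (N0 <= s)%N -> (eta s * s%:R) `^ p = f s `^ p / s%:R.
    by move=> Ns; have := wp s; rewrite /w; have -> : m s = s by rewrite /m; lia.
  rewrite h; last exact: leq_trans br.
  rewrite mulrC -ler_pdivrMr ?ltr0n//; apply: fn2 => //.
  by move: Nb; rewrite /N0; lia.
Qed.

End Weight.

(** * Finite counting and Lipschitz bounds for weighted tents *)

Lemma size_flatten_le (T U : Type) (F : T -> seq U) (l : seq T) (c : nat) :
  (forall x, (size (F x) <= c)%N) -> (size (flatten (map F l)) <= size l * c)%N.
Proof.
move=> h; elim: l => //= x l IH.
by rewrite size_cat mulSn leq_add.
Qed.

Lemma big_uniq_support (R : realType) (T : eqType) (L L' : seq T) (F : T -> R) :
  uniq L -> uniq L' -> {subset L <= L'} ->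
  (forall z, z \in L' -> F z != 0 -> z \in L) ->
  \sum_(z <- L') F z = \sum_(z <- L) F z.
Proof.
move=> uL uL' sub sup.
rewrite (bigID (fun z => z \in L))/= [X in _ + X]big_seq_cond.
rewrite [X in _ + X]big1 ?addr0; last first.
  by move=> z /andP[zL' zL]; apply/eqP; apply: contraNT zL => /(sup z zL').
rewrite -big_filter; apply: perm_big; apply: uniq_perm => //.
  exact: filter_uniq.
by move=> z; rewrite mem_filter; case zL: (z \in L) => //=; apply: sub.
Qed.

Section EtaField.
Variables (R : realType) (p : R).
Hypothesis hp : 1 < p.
Variables (eta : nat -> R) (Be : R).
Hypothesis eta0 : forall t, 0 < eta t.
Hypothesis eta1 : forall r, eta r.+1 <= eta r.
Hypothesis eta2 : forall r, (eta r - eta r.+1) * r.+1%:R <= 2 * eta r.+1.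
Hypothesis Be0 : 0 <= Be.
Hypothesis eta3 : forall n, \sum_(t < n) eta t `^ p <= Be `^ p.

Lemma eta_anti r s : (r <= s)%N -> eta s <= eta r.
Proof.
move=> /subnKC <-; elim: (s - r)%N => [|k IH]; first by rewrite addn0.
by rewrite addnS; apply: le_trans IH.
Qed.

(** Discrete product rule: the change of [t] costs [Q * eta], and the change of [eta], multiplied by
    a height of at most [r'.+1], costs a multiple of [eta]. The conditionals keep the bound
    supported where a tent is nonzero, so that supports can be counted. *)
Lemma eta_tent_diff (Q r r' t t' : nat) :
  (r <= r'.+1)%N -> (r' <= r.+1)%N -> (t <= t' + Q)%N -> (t' <= t + Q)%N ->
  (t' <= r'.+1)%N ->
  `|eta r * t%:R - eta r' * t'%:R| <=
    (if t != 0%N then (Q%:R + 4) * eta r else 0) +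
    (if t' != 0%N then (Q%:R + 4) * eta r' else 0).
Proof.
move=> rr' r'r tt' t't tr'.
have e0 := eta0 r; have e0' := eta0 r'.
have Q0 : 0 <= Q%:R :> R by [].
have nonneg : 0 <= (Q%:R + 4) * eta r by apply: mulr_ge0; [lra|exact: ltW].
have nonneg' : 0 <= (Q%:R + 4) * eta r' by apply: mulr_ge0; [lra|exact: ltW].
have [t0|t0] := eqVneq t 0%N.
  have [t0'|t0'] := eqVneq t' 0%N; first by rewrite t0 t0' !mulr0 subrr normr0 addr0.
  rewrite t0 mulr0 sub0r normrN add0r ger0_norm; last by rewrite mulr_ge0// ltW.
  rewrite mulrC ler_wpM2r//; first exact: ltW.
  have : t'%:R <= Q%:R :> R by rewrite ler_nat; lia.
  lra.
have [t0'|t0'] := eqVneq t' 0%N.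
  rewrite t0' mulr0 subr0 addr0 ger0_norm; last by rewrite mulr_ge0// ltW.
  rewrite mulrC ler_wpM2r//; first exact: ltW.
  have : t%:R <= Q%:R :> R by rewrite ler_nat; lia.
  lra.
rewrite /=; have -> : eta r * t%:R - eta r' * t'%:R =
    eta r * (t%:R - t'%:R) + (eta r - eta r') * t'%:R by ring.
apply: le_trans (ler_normD _ _) _; rewrite !normrM (gtr0_norm e0).
have d1 : `|t%:R - t'%:R| <= Q%:R :> R.
  rewrite ler_norml; apply/andP; split.
    have : t'%:R <= t%:R + Q%:R :> R by rewrite -natrD ler_nat.
    lra.
  have : t%:R <= t'%:R + Q%:R :> R by rewrite -natrD ler_nat.
  lra.
have d2 : eta r * `|t%:R - t'%:R| <= eta r * Q%:R.
  by apply: ler_wpM2l => //; exact: ltW.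
suff d3 : `|eta r - eta r'| * `|t'%:R| <= 4 * eta r + 4 * eta r'.
  have : 0 <= Q%:R * eta r' by rewrite mulr_ge0// ltW.
  lra.
rewrite (ger0_norm (ler0n _ _)).
have tr : t'%:R <= r'.+1%:R :> R by rewrite ler_nat.
have [rE|[rE|rE]] : r' = r \/ r' = r.+1 \/ r = r'.+1 by clear -rr' r'r; lia.
- rewrite rE subrr normr0 mul0r; lra.
- have dd : 0 <= eta r - eta r.+1 by rewrite subr_ge0.
  rewrite rE in tr e0' *; rewrite ger0_norm//.
  have r2 : r.+2%:R <= 2 * r.+1%:R :> R by rewrite -natrM ler_nat mul2n -addnn addSn ltnS leq_addl.
  have := ler_wpM2l dd (le_trans tr r2); have := eta2 r; lra.
- have dd : 0 <= eta r' - eta r'.+1 by rewrite subr_ge0.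
  rewrite rE in e0 *; rewrite distrC ger0_norm//.
  have := ler_wpM2l dd tr; have := eta2 r'; lra.
Qed.

(** Coordinates may be counted by any index [h] below [r], since [eta] is non-increasing. For long
    pieces they are counted by position on a geodesic and not by distance to the piece. *)
Lemma lple_field (S : choiceType) (r t h : S -> nat) (Q : R) (M : nat) :
  0 <= Q -> (forall s, t s != 0%N -> (h s <= r s)%N) ->
  (forall k, exists2 l : seq S, (size l <= M)%N &
     forall s, t s != 0%N -> h s = k -> s \in l) ->
  lple p (fun s => if t s != 0%N then Q * eta (r s) else 0) (Q * (M%:R * Be)).
Proof.
move=> Q0 hr hl.
apply: (lple_fiber hp (h := h) (eta := eta)) => //.
- by move=> k; exact: ltW.
- move=> s; case: ifP => [ts _|_]; last by rewrite eqxx.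
  rewrite ger0_norm ?mulr_ge0 ?(ltW (eta0 _))//.
  by apply: ler_wpM2l => //; apply: eta_anti; exact: hr.
- move=> k; have [l sl ml] := hl k; exists l => // s.
  by case: ifP => [ts _|_]; [exact: ml|rewrite eqxx].
Qed.

Lemma tent_field_lip (S : choiceType) (r r' t t' h h' : S -> nat) (Q M : nat) :
  (forall s, (r s <= (r' s).+1)%N) -> (forall s, (r' s <= (r s).+1)%N) ->
  (forall s, (t s <= t' s + Q)%N) -> (forall s, (t' s <= t s + Q)%N) ->
  (forall s, (t' s <= (r' s).+1)%N) ->
  (forall s, t s != 0%N -> (h s <= r s)%N) ->
  (forall s, t' s != 0%N -> (h' s <= r' s)%N) ->
  (forall k, exists2 l : seq S, (size l <= M)%N &
     forall s, t s != 0%N -> h s = k -> s \in l) ->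
  (forall k, exists2 l : seq S, (size l <= M)%N &
     forall s, t' s != 0%N -> h' s = k -> s \in l) ->
  lple p (fun s => eta (r s) * (t s)%:R - eta (r' s) * (t' s)%:R)
    ((Q%:R + 4) * (M%:R * Be) + (Q%:R + 4) * (M%:R * Be)).
Proof.
move=> h1 h2 h3 h4 h5 h6 h7 h8 h9.
have Q0 : 0 <= Q%:R + 4 :> R by rewrite addr_ge0.
have nn : 0 <= (Q%:R + 4) * (M%:R * Be) by rewrite !mulr_ge0.
have b1 := lple_field Q0 h6 h8.
have b2 := lple_field Q0 h7 h9.
apply: (lple_mono hp) (lple_add hp nn nn b1 b2) => //; last exact: addr_ge0.
move=> s; apply: le_trans (ler_norm _); exact: eta_tent_diff.
Qed.

End EtaField.

(** * The fields of short and long pieces *)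

Section Fields.
Variables (X : choiceType) (adj : X -> X -> Prop).
Hypothesis adjS : forall x y, adj x y -> adj y x.
Hypothesis conn : forall x y, exists n, walk adj n x y.
Variables (e : X) (I : choiceType) (A : I -> set X) (kap : nat).

Local Notation d := (gdist adj).
Local Notation geod := (is_geod adj e).

Hypothesis C2 : forall i g h, geod g -> geod h ->
  (d (gstart g) (gstart h) <= 1)%N \/
    (4 * d (gstart g) (gstart h) <= ndist adj (gstart g) (A i))%N ->
  (meets g (A i) -> meets h (A i) -> (d (dplus g (A i)) (dplus h (A i)) <= kap)%N) /\
  (meets g (A i) -> ~ meets h (A i) -> (ilen adj g (A i) <= kap)%N).
Hypothesis C3 : forall x, exists2 l : seq I, (size l <= kap)%N & forall i, A i x -> i \in l.
Variables (bl : X -> nat -> seq X) (B : nat -> nat).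
Hypothesis hbl : forall x r, [/\ uniq (bl x r), (size (bl x r) <= B r)%N &
        forall y, (d x y <= r)%N -> y \in bl x r].
Variable q : I -> X.
Hypothesis hq : forall i g, geod g -> meets g (A i) ->
  (d (dminus g (A i)) (q i) <= kap)%N /\ A i (q i).
Variable gam : X -> geo X.
Hypothesis gamP : forall x, geod (gam x) /\ gstart (gam x) = x.

Let dsym := gdist_sym adjS conn.
Let dtri := gdist_tri conn.
Let hgam x : geod (gam x) := (gamP x).1.
Let sgam x : gstart (gam x) = x := (gamP x).2.
Let facts := domain_facts adjS conn.

Notation C0 := (tent_cst kap).
Notation lam := (lam kap).

Definition rad (x : X) (i : I) : nat := ndist adj x (A i).

Lemma rad_lip x y i : (d x y <= 1)%N -> (rad y i <= (rad x i).+1)%N.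
Proof. have := ndist_lip conn y x (A i); rewrite dsym /rad; lia. Qed.

Lemma C0_5 : (5 <= C0)%N. Proof. by rewrite /tent_cst; lia. Qed.

Definition entries (i : I) (z : X) : set X :=
  [set y | exists g, [/\ geod g, gstart g = y, meets g (A i) & z = dplus g (A i)]].

Definition long_entries (i : I) (z : X) : set X :=
  [set y | exists g, [/\ geod g, gstart g = y, meets g (A i), z = dplus g (A i) &
                        (kap < ilen adj g (A i))%N]].

(** The coordinate [((i, z), m)] stands [m] steps after the entry point. The slack [3 * kap] absorbs
    the moves of entry and exit, so that this position stays in the domain of [gam x]; [m = 0] is
    always allowed. Subtracting [m] forces [m <= rad x i] on the support. *)
Definition long_height (x : X) (c : (I * X) * nat) : nat :=
  if (c.2 == 0)%N || (c.2 + 3 * kap < d c.1.2 (q c.1.1))%N then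
    (tent adj C0 x (long_entries c.1.1 c.1.2) (rad x c.1.1) - c.2)%N
  else 0%N.

Lemma long_height_le x c : (long_height x c <= (rad x c.1.1).+1)%N.
Proof.
rewrite /long_height; case: ifP => // _.
have := tent_le adj C0 x (long_entries c.1.1 c.1.2) (rad x c.1.1); lia.
Qed.

Lemma long_height_lip x y c : (d x y <= 1)%N ->
  (long_height y c <= long_height x c + 2 * C0.+1)%N.
Proof.
move=> xy; rewrite /long_height; case: ifP => // _.
have := tent_lip conn C0 (long_entries c.1.1 c.1.2) xy (rad_lip c.1.1 xy); lia.
Qed.

Lemma near_proj x y i g : geod g -> gstart g = y -> (C0 * d x y <= rad x i)%N ->
  (d (proj A q (gam x) i) (proj A q g i) <= 2 * kap)%N.
Proof.
move=> hg gy hd; apply: (proj_near adjS conn C2 hq) => //.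
right; rewrite sgam gy; apply: leq_trans hd.
by rewrite leq_mul2r C0_5 orbT.
Qed.

(** Position on [gam x] used as counting index. The entry is at most [lam * rad] and [m] at most
    [rad], so division by [2 * lam] brings it below [rad]. *)
Definition domain_fiber (x : X) (i : I) (m : nat) : nat :=
  ((kmin (gam x) (A i) + m) %/ (2 * lam))%N.

(** A nonzero tent provides a geodesic from a nearby point whose domain is longer than [kap]. The
    second half of (C2) then forbids [gam x] to miss the piece, and the first half locates its entry
    point. *)
Lemma long_height_domain x i z m : long_height x ((i, z), m) != 0%N ->
  [/\ meets (gam x) (A i), (kmin (gam x) (A i) + m <= kmax (gam x) (A i))%N,
      (d (dplus (gam x) (A i)) z <= kap)%N & (m <= rad x i)%N].
Proof.
rewrite /long_height /=; case: ifP => //; rewrite -lt0n => cond h.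
have [|y [[g [hg gy mg zE il]] hy tE]] := tent_gt0 (adj := adj) (C0 := C0) (x := x)
  (P := long_entries i z) (r := rad x i); first lia.
have lip := ndist_lip conn x y (A i).
have c5 : (5 * d x y <= rad x i)%N.
  by apply: leq_trans hy; rewrite leq_mul2r C0_5 orbT.
have c4 : (d (gstart g) (gstart (gam x)) <= 1)%N \/
    (4 * d (gstart g) (gstart (gam x)) <= ndist adj (gstart g) (A i))%N.
  right; rewrite gy sgam (dsym y); move: c5; rewrite /rad; lia.
have [c c'] := C2 hg (hgam x) c4.
have mx : meets (gam x) (A i) by apply: contrapT => /(c' mg); lia.
have cc := c mg mx; rewrite -zE dsym in cc.
have [[x1 x2 x3 x4 x5] [x6 x7 x8 x9 x10]] := facts (hgam x) mx.
have [hqx _] := hq (hgam x) mx.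
split=> //; last lia.
have := dtri z (dplus (gam x) (A i)) (q i); rewrite (dsym z (dplus _ _)).
have := dtri (dplus (gam x) (A i)) (dminus (gam x) (A i)) (q i).
lia.
Qed.

Lemma domain_fiber_le x i m : meets (gam x) (A i) -> (m <= rad x i)%N ->
  (domain_fiber x i m <= rad x i)%N.
Proof.
move=> mx mr; have [_] := entry_dist adjS conn C2 hq (hgam x) mx.
rewrite sgam -/(rad x i) => h; rewrite /domain_fiber.
have l0 : (0 < lam)%N by [].
have : (kmin (gam x) (A i) + m <= rad x i * (2 * lam))%N.
  have : (rad x i <= lam * rad x i)%N by apply: leq_pmull.
  lia.
move=> /(leq_div2r (2 * lam)); rewrite mulnK//.
Qed.

(** An index [k] stands for [2 * lam] consecutive vertices of [gam x]. Each is within [kap] of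
    boundedly many pieces by [domain_close] and (C3); then [z] is near the entry of [gam x], and the
    vertex determines [m]. *)
Lemma long_support x k : exists2 l : seq ((I * X) * nat),
  (size l <= (2 * lam) * ((B kap * kap) * B kap))%N &
  forall c, long_height x c != 0%N -> domain_fiber x c.1.1 c.2 = k -> c \in l.
Proof.
have /choice [f hf] : forall v, exists l : seq I, (size l <= B kap * kap)%N /\
    forall i w, A i w -> (d v w <= kap)%N -> i \in l.
  by move=> v; have [l] := pieces_near C3 hbl v kap; exists l.
pose H (s : nat) i := [seq ((i, z), (s - kmin (gam x) (A i))%N) |
                         z <- bl (dplus (gam x) (A i)) kap].
pose F s := flatten (map (H s) (f ((gam x).2 s))).
exists (flatten (map F (iota (k * (2 * lam)) (2 * lam)))).
  have : (size (flatten (map F (iota (k * (2 * lam)) (2 * lam)))) <=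
          size (iota (k * (2 * lam)) (2 * lam)) * ((B kap * kap) * B kap))%N.
    apply: size_flatten_le => s.
    apply: (@leq_trans (size (f ((gam x).2 s)) * B kap)).
      apply: size_flatten_le => i; rewrite size_map.
      by have [] := hbl (dplus (gam x) (A i)) kap.
    by rewrite leq_mul2r; have [-> _] := hf ((gam x).2 s); rewrite orbT.
  by rewrite size_iota.
move=> [[i z] m] hc hk'.
have hk : ((kmin (gam x) (A i) + m) %/ (2 * lam))%N = k := hk'.
have [mx sm dz mr] := long_height_domain hc.
set s := (kmin (gam x) (A i) + m)%N in hk sm.
apply/flattenP; exists (F s).
  apply: map_f; rewrite mem_iota -hk leq_divM /=.
  rewrite -[X in (_ < _ + X)%N]mul1n -mulnDl addn1; exact: ltn_ceil.
apply/flattenP; exists (H s i).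
  apply: map_f.
  have [w Aw dw] := domain_close adjS conn C2 (hgam x) mx (leq_addr m _) sm.
  by have [_] := hf ((gam x).2 s); apply; [exact: Aw|].
have mE : m = (s - kmin (gam x) (A i))%N by rewrite /s addKn.
rewrite /H {1}mE.
by apply: map_f; have [_ _] := hbl (dplus (gam x) (A i)) kap; apply.
Qed.

Lemma meeting_support x k : exists2 l : seq I, (size l <= (2 * lam) * kap)%N &
  forall i, meets (gam x) (A i) -> domain_fiber x i 0 = k -> i \in l.
Proof.
have /choice [f hf] : forall v, exists l : seq I, (size l <= kap)%N /\
    forall i, A i v -> i \in l.
  by move=> v; have [l] := C3 v; exists l.
pose F s := f ((gam x).2 s).
exists (flatten (map F (iota (k * (2 * lam)) (2 * lam)))).
  have : (size (flatten (map F (iota (k * (2 * lam)) (2 * lam)))) <=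
          size (iota (k * (2 * lam)) (2 * lam)) * kap)%N.
    by apply: size_flatten_le => s; have [] := hf ((gam x).2 s).
  by rewrite size_iota.
move=> i mx; rewrite /domain_fiber addn0 => hk.
apply/flattenP; exists (F (kmin (gam x) (A i))).
  apply: map_f; rewrite mem_iota -hk leq_divM /=.
  rewrite -[X in (_ < _ + X)%N]mul1n -mulnDl addn1; exact: ltn_ceil.
by have [_] := hf ((gam x).2 (kmin (gam x) (A i))); apply; have [] := kmin_spec mx.
Qed.

Variables (R : realType) (K : R).

Definition excluders (z : X) : set X :=
  [set y | exists g j, [/\ geod g, gstart g = y, meets g (A j) &
     5 * K <= (ilen adj g (A j))%:R /\
     ((d e (dminus g (A j)))%:R + 2 * K <= (d e z)%:R /\
      (d e z)%:R <= (d e (dplus g (A j)))%:R - 2 * K)]].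

Definition short_height (x : X) (c : I * X) : nat :=
  (tent adj C0 x (entries c.1 c.2) (rad x c.1) -
   tent adj C0 x (excluders c.2) (rad x c.1))%N.

Lemma short_height_le x c : (short_height x c <= (rad x c.1).+1)%N.
Proof. have := tent_le adj C0 x (entries c.1 c.2) (rad x c.1); rewrite /short_height; lia. Qed.

Lemma short_height_lip x y c : (d x y <= 1)%N ->
  (short_height y c <= short_height x c + 2 * C0.+1)%N.
Proof.
move=> xy; have yx : (d y x <= 1)%N by rewrite dsym.
have := tent_lip conn C0 (entries c.1 c.2) xy (rad_lip c.1 xy).
have := tent_lip conn C0 (excluders c.2) yx (rad_lip c.1 yx).
rewrite /short_height; lia.
Qed.

(** Both tents have the same height and slope, so a positive difference gives a start [y] of a
    geodesic entering at [z] that is strictly closer to [x] than every excluder. Hence [z] is a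
    boundary point for [k = d x y], and the slope keeps [k] below a quarter of the distance to the
    piece. *)
Lemma short_height_bdry x i z : short_height x (i, z) != 0%N ->
  bdryx adj e A K x i z /\ A i z /\ (d (proj A q (gam x) i) z <= 2 * kap)%N.
Proof.
rewrite -lt0n /short_height /= => h.
have [|y [[g [hg gy mg zE]] hy tE]] := tent_gt0 (adj := adj) (C0 := C0) (x := x)
  (P := entries i z) (r := rad x i); first lia.
have Az : A i z by rewrite zE; have [[]] := facts hg mg.
split; last first.
  by split=> //; have := near_proj (i := i) hg gy hy; rewrite (proj_meets _ mg) -zE.
exists (d x y); split.
  rewrite dset_ndist; last by exists z.
  rewrite ler_pdivlMr// -natrM ler_nat.
  apply: leq_trans hy; rewrite mulnC leq_mul2r; have := C0_5; lia.
split.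
  by exists g; [split=> //; rewrite gy|].
move=> g' j [hg' dg'] mg' l5 bad.
have ex : excluders z (gstart g') by exists g', j.
have := tent_ge adj C0 x (rad x i) ex.
have : (C0 * d x (gstart g') <= C0 * d x y)%N by rewrite leq_mul2l dg' orbT.
lia.
Qed.

Hypothesis K0 : 0 < K.
Hypothesis C4 : forall x (t : nat), exists2 l : seq I, (size l <= kap)%N &
  forall i, Ix adj e A K x i -> A i !=set0 -> ndist adj x (A i) = t -> i \in l.

(** Either [i] is in [Ix] and (C4) counts it, or a boundary point of the piece, which lies in [A i],
    is within [3 * K] of [e], and the pieces near [e] are finitely many. For each [i] the point [z]
    is close to the projection of [gam x]. *)
Lemma short_support x k : exists2 l : seq (I * X),
  (size l <= (kap + B (Num.truncn (3 * K)) * kap) * B (2 * kap))%N &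
  forall c, short_height x c != 0%N -> rad x c.1 = k -> c \in l.
Proof.
have [l4 s4 m4] := C4 x k.
have [l5 s5 m5] := pieces_near C3 hbl e (Num.truncn (3 * K)).
pose F i := [seq (i, z) | z <- bl (proj A q (gam x) i) (2 * kap)].
exists (flatten (map F (l4 ++ l5))).
  apply: (@leq_trans (size (l4 ++ l5) * B (2 * kap))).
    apply: size_flatten_le => i; rewrite size_map.
    by have [] := hbl (proj A q (gam x) i) (2 * kap).
  by rewrite leq_mul2r size_cat leq_add ?orbT.
move=> [i z] hz rk.
have [hb [Az hd]] := short_height_bdry hz.
apply/flattenP; exists (F i); last first.
  by apply: map_f; have [_ _] := hbl (proj A q (gam x) i) (2 * kap); apply.
apply: map_f; rewrite mem_cat.
have A0 : A i !=set0 by exists z.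
have b0 : bdryx adj e A K x i !=set0 by exists z.
have [ge|lt] := leP (3 * K) (dset (R := R) adj e (bdryx adj e A K x i)).
  by apply/orP; left; apply: m4.
apply/orP; right; rewrite dset_ndist// in lt.
have [[z' [n [_ [[g hg [mg zE]] _]]] dz'] _] := ndistP adj e b0.
apply: (m5 _ z').
  by rewrite zE; have [[]] := facts hg.1 mg.
rewrite dz' truncn_ge_nat; first exact: ltW.
by rewrite mulr_ge0// ltW.
Qed.

End Fields.

(** * Averaged maps inside the pieces *)

Section Average.
Variables (R : realType) (p : R).
Hypothesis hp : 1 < p.
Variables (X : choiceType) (adj : X -> X -> Prop).
Hypothesis adjS : forall x y, adj x y -> adj y x.
Hypothesis conn : forall x y, exists n, walk adj n x y.
Variables (e : X) (I : choiceType) (A : I -> set X) (kap : nat).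

Local Notation d := (gdist adj).
Local Notation geod := (is_geod adj e).

Hypothesis C2 : forall i g h, geod g -> geod h ->
  (d (gstart g) (gstart h) <= 1)%N \/
    (4 * d (gstart g) (gstart h) <= ndist adj (gstart g) (A i))%N ->
  (meets g (A i) -> meets h (A i) -> (d (dplus g (A i)) (dplus h (A i)) <= kap)%N) /\
  (meets g (A i) -> ~ meets h (A i) -> (ilen adj g (A i) <= kap)%N).
Hypothesis C3 : forall x, exists2 l : seq I, (size l <= kap)%N & forall i, A i x -> i \in l.
Variables (bl : X -> nat -> seq X) (B : nat -> nat).
Hypothesis hbl : forall x r, [/\ uniq (bl x r), (size (bl x r) <= B r)%N &
        forall y, (d x y <= r)%N -> y \in bl x r].
Variable q : I -> X.
Hypothesis hq : forall i g, geod g -> meets g (A i) ->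
  (d (dminus g (A i)) (q i) <= kap)%N /\ A i (q i).
Variable gam : X -> geo X.
Hypothesis gamP : forall x, geod (gam x) /\ gstart (gam x) = x.
Variables (Xi : I -> choiceType) (psi : forall i, X -> (Xi i -> R)).
Hypothesis hpsi : forall i x y, A i x -> A i y ->
  lple p (fun s : Xi i => psi x s - psi y s) (d x y)%:R.

Let dxx := gdistxx conn.
Let dsym := gdist_sym adjS conn.
Let dtri := gdist_tri conn.
Let hgam x : geod (gam x) := (gamP x).1.

Notation C0 := (tent_cst kap).
Local Notation rad := (rad adj A).
Local Notation pr := (proj A q).

Definition projecting (i : I) (z : X) : set X :=
  [set y | exists g, [/\ geod g, gstart g = y & pr g i = z]].

Definition weight (x : X) (i : I) (z : X) : nat :=
  tent adj C0 x (projecting i z) (rad x i).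

(* The cut-off discards the pieces not met by [gam x], whose averaged value
   would otherwise be supported on arbitrarily many pieces. *)
Definition cut (i : I) (z : X) (s : Xi i) : R :=
  if (d z (q i) <= 2 * kap)%N then 0 else psi z s - psi (q i) s.

Definition nearby (x : X) (i : I) : seq X := bl (pr (gam x) i) (2 * kap).

Definition mass (x : X) (i : I) : R := \sum_(z <- nearby x i) (weight x i z)%:R.

Definition average (x : X) (i : I) (s : Xi i) : R :=
  (\sum_(z <- nearby x i) (weight x i z)%:R * cut z s) / mass x i.

Lemma weight_proj x i z : weight x i z != 0%N ->
  (exists2 g, geod g & pr g i = z) /\ (d (pr (gam x) i) z <= 2 * kap)%N.
Proof.
rewrite -lt0n => /tent_gt0 [y [[g [hg gy gz]] hy _]]; split; first by exists g.
by rewrite -gz; exact: (near_proj adjS conn C2 hq gamP hg gy hy).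
Qed.

Lemma weight_nearby x i z : weight x i z != 0%N -> z \in nearby x i.
Proof.
by move=> /weight_proj [_ h]; have [_ _] := hbl (pr (gam x) i) (2 * kap); apply.
Qed.

Lemma weight_self x i : weight x i (pr (gam x) i) = (rad x i).+1.
Proof. by apply: tent_in => //; exists (gam x); have [? ?] := gamP x. Qed.

(** The projection of [gam x] alone carries full tent height. Normalising by the mass thus turns
    bounded variations of the weights into variations of order [1 / (rad + 1)]. *)
Lemma mass_ge x i : (rad x i).+1%:R <= mass x i.
Proof.
have w0 : weight x i (pr (gam x) i) != 0%N by rewrite weight_self.
have [ux _ _] := hbl (pr (gam x) i) (2 * kap).
rewrite /mass (bigD1_seq (pr (gam x) i))//=; last exact: weight_nearby.
rewrite weight_self -[leLHS]addr0; apply: lerD => //.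
exact: sumr_ge0.
Qed.

Lemma mass_gt0 x i : 0 < mass x i.
Proof. by apply: lt_le_trans (mass_ge x i); rewrite ltr0n. Qed.

Lemma weight_le_mass x i z : (weight x i z)%:R <= mass x i.
Proof. by apply: le_trans (mass_ge x i); rewrite ler_nat; exact: tent_le. Qed.

Lemma mass_over x i (L : seq X) : uniq L -> {subset nearby x i <= L} ->
  \sum_(z <- L) (weight x i z)%:R = mass x i.
Proof.
move=> uL sub; apply: big_uniq_support => //.
  by have [] := hbl (pr (gam x) i) (2 * kap).
by move=> z _; rewrite pnatr_eq0; exact: weight_nearby.
Qed.

Lemma average_over x i (L : seq X) (s : Xi i) : uniq L -> {subset nearby x i <= L} ->
  average x s = \sum_(z <- L) ((weight x i z)%:R / mass x i) * cut z s.
Proof.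
move=> uL sub; rewrite /average mulr_suml.
rewrite -(big_uniq_support (L := nearby x i) (L' := L))//.
- by apply: eq_bigr => z _; rewrite mulrAC.
- by have [] := hbl (pr (gam x) i) (2 * kap).
- move=> z _; rewrite !mulf_eq0 !negb_or pnatr_eq0 => /andP[/andP[h _] _].
  exact: weight_nearby.
Qed.

(** A value cut to 0 differs from the uncut one by at most [2 * kap], the Lipschitz bound between
    the point and [q i]. A projection farther than that from [q i] is a true entry point, hence lies
    in [A i] where [psi] is controlled. *)
Lemma cut_lip i g h : geod g -> geod h ->
  lple p (fun s : Xi i => cut (pr g i) s - cut (pr h i) s)
    (d (pr g i) (pr h i) + 2 * kap)%:R.
Proof.
move=> hg hh; set z := pr g i; set w := pr h i.
have Aof f : geod f -> (2 * kap < d (pr f i) (q i))%N -> A i (pr f i) /\ A i (q i).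
  move=> hf far; apply: (proj_A adjS conn hq) => //.
  have [mf|mf] := pselect (meets f (A i)).
    by have [_ ?] := kmin_spec mf; exists (f.2 (kmin f (A i))).
  by move: far; rewrite proj_nmeets// dxx.
have [hz|hz] := leqP (d z (q i)) (2 * kap); have [hw|hw] := leqP (d w (q i)) (2 * kap).
- by apply: lple0 => // s; rewrite /cut hz hw subrr.
- have [Aw Aq] := Aof h hh hw.
  apply: (lple_mono hp (v := fun s : Xi i => psi w s - psi (q i) s)) (hpsi Aw Aq) => //.
    by move=> s; rewrite /cut hz leqNgt hw sub0r normrN.
  by rewrite ler_nat -/w; have := dtri w z (q i); rewrite (dsym w z); lia.
- have [Az Aq] := Aof g hg hz.
  apply: (lple_mono hp (v := fun s : Xi i => psi z s - psi (q i) s)) (hpsi Az Aq) => //.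
    by move=> s; rewrite /cut hw leqNgt hz subr0.
  by rewrite ler_nat -/z; have := dtri z w (q i); lia.
- have [Az Aq] := Aof g hg hz; have [Aw _] := Aof h hh hw.
  apply: (lple_mono hp (v := fun s : Xi i => psi z s - psi w s)) (hpsi Az Aw) => //.
    move=> s; rewrite /cut leqNgt hz leqNgt hw /=.
    by rewrite opprB addrA subrK.
  by rewrite ler_nat leq_addr.
Qed.

Lemma average_nmeets x i (s : Xi i) : ~ meets (gam x) (A i) -> average x s = 0.
Proof.
move=> nm; rewrite /average big1_seq ?mul0r// => z _.
have [w0|w0] := eqVneq (weight x i z) 0%N; first by rewrite w0 mul0r.
have [_] := weight_proj w0; rewrite (proj_nmeets _ nm) => h.
by rewrite /cut dsym h mulr0.
Qed.

(** The normalised weights sum to 1 and are carried by at most [B (2 * kap)] points, each within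
    [2 * kap] of the centre; the cut adds [2 * kap] more. *)
Lemma average_center x i :
  lple p (fun s : Xi i => average x s - cut (pr (gam x) i) s)
    ((B (2 * kap))%:R * (1 * (4 * kap)%:R)).
Proof.
set z0 := pr (gam x) i.
have [uL sL _] := hbl z0 (2 * kap).
apply: (lple_ext (v := fun s : Xi i => \sum_(z <- nearby x i)
    ((weight x i z)%:R / mass x i) * (cut z s - cut z0 s))).
  move=> s; rewrite (average_over (L := nearby x i))//.
  under [RHS]eq_bigr do rewrite mulrBr.
  rewrite sumrB -mulr_suml -mulr_suml -/(mass x i) divff ?mul1r//.
  by rewrite gt_eqF// mass_gt0.
have nn : 0 <= 1 * (4 * kap)%:R :> R by rewrite mul1r.
apply: (lple_mono hp (v := fun s : Xi i => \sum_(z <- nearby x i)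
    ((weight x i z)%:R / mass x i) * (cut z s - cut z0 s))
   (a := (size (nearby x i))%:R * (1 * (4 * kap)%:R))) => //.
- by apply: ler_wpM2r => //; rewrite ler_nat.
- apply: lple_lincomb => //.
  + move=> z _; rewrite ger0_norm; last first.
      by apply: divr_ge0 => //; exact: ltW (mass_gt0 x i).
    by rewrite ler_pdivrMr ?mass_gt0// mul1r weight_le_mass.
  + move=> z _; rewrite mulf_eq0 negb_or pnatr_eq0 => /andP[w0 _].
    have [[g hg gz] dz] := weight_proj w0.
    apply: (lple_mono hp _ _ _ (cut_lip (i := i) hg (hgam x))) => //.
      by move=> s; rewrite gz.
    by rewrite gz ler_nat dsym; move: dz; rewrite -/z0; lia.
Qed.

Lemma weight_lip x y i z : (d x y <= 1)%N ->
  `|(weight x i z)%:R - (weight y i z)%:R| <= C0.+1%:R :> R.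
Proof.
move=> xy; have yx : (d y x <= 1)%N by rewrite dsym.
have h1 := tent_lip conn C0 (projecting i z) xy (rad_lip adjS conn A i xy).
have h2 := tent_lip conn C0 (projecting i z) yx (rad_lip adjS conn A i yx).
rewrite -!/(weight _ _ _) in h1 h2.
rewrite ler_norml; apply/andP; split.
  have : (weight y i z)%:R <= (weight x i z)%:R + C0.+1%:R :> R by rewrite -natrD ler_nat.
  lra.
have : (weight x i z)%:R <= (weight y i z)%:R + C0.+1%:R :> R by rewrite -natrD ler_nat.
lra.
Qed.

Definition average_cst : R :=
  (2 * B (2 * kap))%:R * ((1 + 2 * B (2 * kap)) * C0.+1)%:R * (6 * kap)%:R.

(** The differences [c z] of normalised weights sum to 0, so the value at one centre [z0] may be
    subtracted from every [cut z]. What remains are boundedly many differences of bounded norm with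
    coefficients of order [1 / (rad + 1)]. *)
Lemma average_lip x y i : (d x y <= 1)%N ->
  lple p (fun s : Xi i => average x s - average y s)
    (average_cst / (rad x i).+1%:R).
Proof.
move=> xy; set z0 := pr (gam x) i.
pose L := undup (nearby x i ++ nearby y i).
have uL : uniq L by exact: undup_uniq.
have subx : {subset nearby x i <= L} by move=> z h; rewrite mem_undup mem_cat h.
have suby : {subset nearby y i <= L} by move=> z h; rewrite mem_undup mem_cat h orbT.
have szL : (size L <= 2 * B (2 * kap))%N.
  apply: leq_trans (size_undup _) _; rewrite size_cat mul2n -addnn leq_add//.
    by have [] := hbl (pr (gam x) i) (2 * kap).
  by have [] := hbl (pr (gam y) i) (2 * kap).
pose c z := (weight x i z)%:R / mass x i - (weight y i z)%:R / mass y i : R.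
have mx := mass_gt0 x i; have my := mass_gt0 y i.
have sumw u : {subset nearby u i <= L} ->
    \sum_(z <- L) (weight u i z)%:R / mass u i = 1.
  by move=> su; rewrite -mulr_suml (mass_over uL su) divff// gt_eqF// mass_gt0.
apply: (lple_ext (v := fun s : Xi i => \sum_(z <- L) c z * (cut z s - cut z0 s))).
  move=> s; rewrite (average_over s uL subx) (average_over s uL suby).
  under [RHS]eq_bigr do rewrite mulrBr.
  rewrite sumrB -mulr_suml /c sumrB !sumw// subrr mul0r subr0 -sumrB.
  by apply: eq_bigr => z _; rewrite mulrBl.
pose r1 : R := (rad x i).+1%:R.
have r0 : 0 < r1 by rewrite ltr0n.
pose g := ((1 + 2 * B (2 * kap)) * C0.+1)%:R / r1.
have g0 : 0 <= g by apply: divr_ge0 => //; exact: ltW.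
have k0 : 0 <= (6 * kap)%:R :> R by [].
have massd : `|mass y i - mass x i| <= (2 * B (2 * kap) * C0.+1)%:R.
  rewrite -(mass_over uL subx) -(mass_over uL suby) -sumrB.
  apply: le_trans (ler_norm_sum _ _ _) _.
  apply: (@le_trans _ _ (\sum_(z <- L) C0.+1%:R)).
    by apply: ler_sum => z _; rewrite distrC; exact: weight_lip.
  rewrite big_const_seq count_predT iter_addr addr0 -[leLHS]mulr_natl -natrM ler_nat.
  by rewrite leq_mul2r szL orbT.
have hc z : `|c z| <= g.
  (* The change of the weight is separated from the change of the mass; both are divided by
     [mass x i], which is at least [rad + 1]. *)
  have -> : c z = ((weight x i z)%:R - (weight y i z)%:R) / mass x i +
      ((weight y i z)%:R / mass y i) * ((mass y i - mass x i) / mass x i).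
    by rewrite /c; field; rewrite !gt_eqF.
  apply: le_trans (ler_normD _ _) _; rewrite !normrM !normfV !(gtr0_norm mx).
  have ix : (mass x i)^-1 <= r1^-1 by rewrite lef_pV2 ?posrE//; exact: mass_ge.
  have ix0 : 0 <= (mass x i)^-1 by rewrite invr_ge0 ltW.
  have wy : `|(weight y i z)%:R| / `|mass y i| <= 1 :> R.
    rewrite (gtr0_norm my) ger0_norm// ler_pdivrMr// mul1r; exact: weight_le_mass.
  rewrite /g mulnDl mul1n natrD mulrDl; apply: lerD.
    by apply: ler_pM => //; exact: weight_lip.
  rewrite -[leRHS]mul1r; apply: ler_pM => //; last exact: ler_pM.
  exact: mulr_ge0.
apply: (lple_mono hp (v := fun s : Xi i => \sum_(z <- L) c z * (cut z s - cut z0 s))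
   (a := (size L)%:R * (g * (6 * kap)%:R))) => //.
- by apply: mulr_ge0 => //; exact: mulr_ge0.
- have -> : average_cst / (rad x i).+1%:R = (2 * B (2 * kap))%:R * (g * (6 * kap)%:R).
    by rewrite /average_cst /g -/r1; field; rewrite gt_eqF.
  by apply: ler_wpM2r; [exact: mulr_ge0|rewrite ler_nat].
- apply: lple_lincomb => // z _ cz.
  (* A point weighted at [x] is within [2 * kap] of [z0]; one weighted only at [y] is that close to
     the projection of [gam y], itself within [2 * kap] of [z0]. *)
  suff [f hf [fz dz]] : exists2 f, geod f & pr f i = z /\ (d z z0 <= 4 * kap)%N.
    apply: (lple_mono hp _ _ _ (cut_lip (i := i) hf (hgam x))) => //.
      by move=> s; rewrite fz.
    by rewrite fz ler_nat -/z0; clear -dz; lia.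
  have [wx|wx] := eqVneq (weight x i z) 0%N; last first.
    have [[f hf fz] dz] := weight_proj wx; exists f => //; split=> //.
    by rewrite dsym; move: dz; rewrite -/z0; clear; lia.
  have [wy|wy] := eqVneq (weight y i z) 0%N.
    by move: cz; rewrite /c wx wy !mul0r subrr eqxx.
  have [[f hf fz] dz] := weight_proj wy; exists f => //; split=> //.
  have st : (d (gstart (gam x)) (gstart (gam y)) <= 1)%N.
    by have [_ ->] := gamP x; have [_ ->] := gamP y.
  have := proj_near adjS conn C2 hq (i := i) (hgam x) (hgam y) (or_introl st).
  rewrite -/z0 dsym => h.
  by have := dtri z (pr (gam y) i) z0; rewrite (dsym z (pr _ _)); clear -dz h; lia.
Qed.

Variables (eta : nat -> R) (Be c0 : R).
Hypothesis eta0 : forall t, 0 < eta t.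
Hypothesis eta1 : forall r, eta r.+1 <= eta r.
Hypothesis Be0 : 0 <= Be.
Hypothesis eta3 : forall n, \sum_(t < n) eta t `^ p <= Be `^ p.
Hypothesis c00 : 0 < c0.
Hypothesis eta4 : forall r, c0 <= eta r * r.+1%:R.

(** [eta4] bounds [1 / (rad + 1)] by [eta rad / c0]. Only pieces met by [gam x] or [gam y]
    contribute, and these are counted along the two geodesics. *)
Lemma average_field_lip : exists2 C : R, 0 <= C & forall x y, (d x y <= 1)%N ->
  lple p (fun k : {i : I & Xi i} =>
     average x (tagged k) - average y (tagged k)) C.
Proof.
pose C1 := average_cst / c0.
have a0 : 0 <= average_cst by rewrite /average_cst -!natrM.
have C10 : 0 <= C1 by apply: divr_ge0 => //; exact: ltW.
pose M := ((2 * lam kap) * kap)%N.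
have C1M : 0 <= C1 * (M%:R * Be) by apply: mulr_ge0 => //; exact: mulr_ge0.
exists (C1 * (M%:R * Be) + C1 * (M%:R * Be)); first exact: addr_ge0.
move=> x y xy.
pose t u i : nat := `[< meets (gam u) (A i) >].
have tP u i : (t u i != 0%N) = `[< meets (gam u) (A i) >].
  by rewrite /t; case: asboolP.
pose b u i := if t u i != 0%N then C1 * eta (rad u i) else 0.
have b0 u i : 0 <= b u i.
  by rewrite /b; case: ifP => // _; rewrite mulr_ge0// ltW.
have hb u : lple p (b u) (C1 * (M%:R * Be)).
  rewrite /b; apply: (lple_field hp eta0 eta1 Be0 eta3 (r := rad u) (t := t u)
    (h := fun i => domain_fiber A kap gam u i 0)) => //.
    move=> i; rewrite tP => /asboolP mi.
    exact: (domain_fiber_le adjS conn C2 hq gamP).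
  move=> k; have [l sl ml] := meeting_support C3 gam u k; exists l => // i.
  by rewrite tP => /asboolP mi; exact: ml.
have bnd u v i : (d u v <= 1)%N -> meets (gam u) (A i) ->
    lple p (fun s : Xi i => average u s - average v s) (b u i).
  move=> uv mi; apply: (lple_mono hp _ _ _ (average_lip (i := i) uv)) => //.
    by apply: divr_ge0.
  rewrite /b tP; case: asboolP => // _.
  rewrite /C1 -mulrA; apply: ler_wpM2l => //.
  rewrite ler_pdivlMl// ler_pdivrMr ?ltr0n//; exact: eta4.
apply: (lple_sigT (T := Xi) (b := fun i => b x i + b y i)).
- by move=> i; exact: addr_ge0.
- move=> i /=; have [mx|mx] := pselect (meets (gam x) (A i)).
    apply: (lple_mono hp _ _ _ (bnd x y i xy mx)) => //.
    by rewrite lerDl.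
  have [my|my] := pselect (meets (gam y) (A i)).
    have yx : (d y x <= 1)%N by rewrite dsym.
    apply: (lple_mono hp _ _ _ (bnd y x i yx my)) => //.
      by move=> s; rewrite distrC.
    by rewrite lerDr.
  by apply: lple0 => // s; rewrite !average_nmeets// subrr.
- exact: lple_add.
Qed.

End Average.

(** * Coordinates that separate two distant points *)

Section Separation.
Variables (X : choiceType) (adj : X -> X -> Prop).
Hypothesis adjS : forall x y, adj x y -> adj y x.
Hypothesis conn : forall x y, exists n, walk adj n x y.
Variables (e : X) (I : choiceType) (A : I -> set X) (kap : nat).

Local Notation d := (gdist adj).
Local Notation geod := (is_geod adj e).

Hypothesis cover : forall x, exists i, A i x.
Hypothesis C1 : forall i g h, geod g -> geod h -> meets g (A i) -> meets h (A i) ->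
  (d (dminus g (A i)) (dminus h (A i)) <= kap)%N.
Hypothesis C2 : forall i g h, geod g -> geod h ->
  (d (gstart g) (gstart h) <= 1)%N \/
    (4 * d (gstart g) (gstart h) <= ndist adj (gstart g) (A i))%N ->
  (meets g (A i) -> meets h (A i) -> (d (dplus g (A i)) (dplus h (A i)) <= kap)%N) /\
  (meets g (A i) -> ~ meets h (A i) -> (ilen adj g (A i) <= kap)%N).
Variable q : I -> X.
Hypothesis hq : forall i g, geod g -> meets g (A i) ->
  (d (dminus g (A i)) (q i) <= kap)%N /\ A i (q i).
Variable gam : X -> geo X.
Hypothesis gamP : forall x, geod (gam x) /\ gstart (gam x) = x.

Let dsym := gdist_sym adjS conn.
Let dtri := gdist_tri conn.
Let hgam x : geod (gam x) := (gamP x).1.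
Let sgam x : gstart (gam x) = x := (gamP x).2.
Let facts := domain_facts adjS conn.

Notation C0 := (tent_cst kap).
Local Notation lm := (lam kap).
Local Notation rad := (rad adj A).
Local Notation pr := (proj A q).
Local Notation smin x i := (kmin (gam x) (A i)).
Local Notation smax x i := (kmax (gam x) (A i)).

Variables x y : X.
Hypothesis xy_gt0 : (0 < d x y)%N.
Hypothesis depth : (d y e <= d x e)%N.

Lemma half_depth : (d x y <= 2 * d x e)%N.
Proof. have := dtri x e y; rewrite (dsym e y); lia. Qed.

(** Put [z = (gam x).2 s]. As [y] is no deeper than [x], comparing depths gives
    [d (gstart g) z <= s + d y (gstart g)], while [d y z >= d x y - s >= 3 * s]. With
    [d y (gstart g)] at most a twentieth of [d y z] this is impossible. *)
Lemma far_entry i s g : (4 * s <= d x y)%N -> geod g -> meets g (A i) ->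
  (gam x).2 s = dplus g (A i) -> (C0 * d y (gstart g) <= rad y i)%N -> False.
Proof.
move=> s4 hg mg zE hr.
have hd := half_depth.
have glen := geod_len (hgam x); rewrite sgam in glen.
have sl : (s <= (gam x).1)%N by lia.
have [[g1 g2 g3 Az _] [g4 g5 _ _ _]] := facts hg mg.
have dz := geod_end conn (hgam x) sl.
have dxz := geod_dist conn (hgam x) (leq0n s) sl.
rewrite -/(gstart (gam x)) sgam subn0 in dxz.
rewrite -zE in Az g4 g5; set z := (gam x).2 s in dz dxz Az g4 g5.
have ry : (rad y i <= d y z)%N.
  by have [_] := ndistP adj y (ex_intro _ z Az : A i !=set0); apply.
have t1 := dtri x z y.
have t2 := dtri (gstart g) y e.
have t3 := dtri y (gstart g) z.
rewrite (dsym z y) in t1; rewrite (dsym (gstart g) y) in t2.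
have : (20 * d y (gstart g) <= C0 * d y (gstart g))%N.
  by rewrite leq_mul2r; apply/orP; right; rewrite /tent_cst; lia.
lia.
Qed.

Lemma short_height_far (R : realType) (K : R) i s : (4 * s <= d x y)%N ->
  short_height adj e A kap K y (i, (gam x).2 s) = 0%N.
Proof.
move=> s4; apply/eqP; rewrite -leqn0 leqNgt; apply/negP; rewrite /short_height /= => h.
have [|u [[g [hg gu mg zE]] hu _]] := tent_gt0 (adj := adj) (C0 := C0) (x := y)
  (P := entries adj e A i ((gam x).2 s)) (r := rad y i); first lia.
by rewrite -gu in hu; exact: (far_entry s4 hg mg zE hu).
Qed.

Lemma long_height_far i s m : (4 * s <= d x y)%N ->
  long_height adj e A kap q y ((i, (gam x).2 s), m) = 0%N.
Proof.
move=> s4; apply/eqP; rewrite -leqn0 leqNgt; apply/negP; rewrite /long_height /=.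
case: ifP => // _ h.
have [|u [[g [hg gu mg zE _]] hu _]] := tent_gt0 (adj := adj) (C0 := C0) (x := y)
  (P := long_entries adj e A kap i ((gam x).2 s)) (r := rad y i); first lia.
by rewrite -gu in hu; exact: (far_entry s4 hg mg zE hu).
Qed.

Lemma dplus_gam i : dplus (gam x) (A i) = (gam x).2 (smin x i).
Proof. by []. Qed.

Variable b : nat.
Hypothesis b_gt0 : (0 < b)%N.
Hypothesis b_hi : (d x y <= 128 * b)%N.
Hypothesis b_lo : (64 * b <= d x y)%N.

(** If [gam y] misses the piece, it projects to the exit, at least [b - kap] from the entry.
    Otherwise comparing depths bounds [d x y] by twice the entry index plus twice the distance of
    the entries, so close entries contradict [64 * b <= d x y]. *)
Lemma jump_far i : meets (gam x) (A i) -> (smin x i < b)%N -> (2 * b <= smax x i)%N ->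
  (b - kap <= d (pr (gam x) i) (pr (gam y) i))%N.
Proof.
move=> mx s1 s2; rewrite (proj_meets q mx).
have [[x1 x2 x3 _ _] [x4 x5 x6 x7 _]] := facts (hgam x) mx.
rewrite sgam in x3 x4.
have [my|my] := pselect (meets (gam y) (A i)); last first.
  rewrite proj_nmeets//; have [hx _] := hq (hgam x) mx.
  have := dtri (dplus (gam x) (A i)) (q i) (dminus (gam x) (A i)).
  rewrite (dsym (q i)); lia.
rewrite (proj_meets q my).
have [[y1 y2 y3 _ _] [y4 y5 _ _ _]] := facts (hgam y) my.
rewrite sgam in y3 y4.
set z0 := dplus (gam x) (A i) in x4 x5 *; set z1 := dplus (gam y) (A i) in y4 y5 *.
have t1 := dtri x z0 y; have t2 := dtri z0 z1 y; have t3 := dtri z0 z1 e.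
rewrite (dsym z1 y) in t2.
have hd := half_depth.
lia.
Qed.

(** Vertices of a domain per value of [m]. For indices up to [32 * b] and entries at least [b], the
    factor [64 * lm] ensures [2 * m <= rad], which keeps half the height of the tent. *)
Definition spread := (64 * lm)%N.

Lemma long_coord s j : (4 * s <= d x y)%N -> meets (gam x) (A j) ->
  (smin x j <= s)%N -> (s <= smax x j)%N -> (kap < ilen adj (gam x) (A j))%N ->
  (b <= smin x j)%N ->
  exists c : (I * X) * nat,
   [/\ long_height adj e A kap q y c = 0%N, (b %/ lm <= rad x c.1.1)%N,
       (rad x c.1.1 <= 2 * long_height adj e A kap q x c)%N &
       (d x c.1.2 + spread * c.2 <= s <= d x c.1.2 + spread * c.2 + spread)%N].
Proof.
move=> s4 mj sj1 sj2 il bj.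
have [[x1 x2 x3 Az _] [x4 x5 x6 x7 x8]] := facts (hgam x) mj.
have [r1 r2] := entry_dist adjS conn C2 hq (hgam x) mj.
rewrite sgam in x3 x4 r1 r2; rewrite -/(rad x j) in r1 r2.
have [hqx _] := hq (hgam x) mj.
set z := dplus (gam x) (A j) in Az x4 x5 x7.
pose m := ((s - smin x j) %/ spread)%N.
have sp0 : (0 < spread)%N by rewrite /spread /lam; lia.
have m1 : (m * spread <= s - smin x j)%N by exact: leq_divM.
have m2 : (s - smin x j < m.+1 * spread)%N by exact: ltn_ceil.
have lz : tent adj C0 x (long_entries adj e A kap j z) (rad x j) = (rad x j).+1.
  by apply: tent_in => //; exists (gam x).
have cond : (m == 0)%N || (m + 3 * kap < d z (q j))%N.
  have [->//|m0 /=] := eqVneq m 0%N.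
  have tz := dtri z (q j) (dminus (gam x) (A j)); rewrite (dsym (q j)) in tz.
  have : (m * (4 * kap).+2 <= m * spread)%N.
    by rewrite leq_mul2l /spread /lam; apply/orP; right; lia.
  have : (kap <= m * kap)%N by apply: leq_pmull; lia.
  lia.
have hx : long_height adj e A kap q x ((j, z), m) = ((rad x j).+1 - m)%N.
  by rewrite /long_height cond lz.
have lm0 : (0 < lm)%N by rewrite /lam.
have mr : (2 * m <= rad x j)%N.
  have h1 : (m * (64 * lm) <= 32 * b)%N by rewrite -/spread; lia.
  have h2 : (lm * (2 * m) <= lm * rad x j)%N by lia.
  by move: h2; rewrite leq_pmul2l.
exists ((j, z), m); rewrite hx /=; split.
- by apply: long_height_far; lia.
- by apply: leq_trans (leq_div2r lm (leq_trans bj r2)) _; rewrite mulKn.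
- lia.
- rewrite x4; apply/andP; split; lia.
Qed.

(** Take a piece through vertex [s]. If its domain is longer than [kap], use a long coordinate. If
    not, its entry is within [kap] of [s]: with no excluder in range the short coordinate has full
    height, and otherwise [excluded_covered] gives a long domain of [gam x] through the entry. *)
Lemma short_coord (R : realType) (K : R) s :
  0 < K -> kap%:R <= K -> (forall n : nat, n%:R <= K -> (n <= kap)%N) ->
  (4 * s <= d x y)%N -> (2 * b + kap <= s)%N ->
  (forall i, meets (gam x) (A i) -> (smin x i < b)%N -> (smax x i < 2 * b)%N) ->
  exists c : (I * X) + ((I * X) * nat),
    match c with
    | inl c => [/\ short_height adj e A kap K y c = 0%N, (b %/ lm <= rad x c.1)%N,
        (rad x c.1 <= 2 * short_height adj e A kap K x c)%N &
        (d x c.2 <= s <= d x c.2 + (spread + kap))%N]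
    | inr c => [/\ long_height adj e A kap q y c = 0%N, (b %/ lm <= rad x c.1.1)%N,
        (rad x c.1.1 <= 2 * long_height adj e A kap q x c)%N &
        (d x c.1.2 + spread * c.2 <= s <= d x c.1.2 + spread * c.2 + (spread + kap))%N]
    end.
Proof.
move=> K0 kK Kk s4 sb nojump.
have covered s' j : (s' <= s)%N -> (s <= s' + kap)%N -> meets (gam x) (A j) ->
    (smin x j <= s')%N -> (s' <= smax x j)%N -> (kap < ilen adj (gam x) (A j))%N ->
    exists c : (I * X) * nat,
    [/\ long_height adj e A kap q y c = 0%N, (b %/ lm <= rad x c.1.1)%N,
        (rad x c.1.1 <= 2 * long_height adj e A kap q x c)%N &
        (d x c.1.2 + spread * c.2 <= s <= d x c.1.2 + spread * c.2 + (spread + kap))%N].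
  move=> ss' s's mj h1 h2 h3.
  have s4' : (4 * s' <= d x y)%N by lia.
  (* A domain starting before [b] would end before [2 * b], but [s'] is at least [s - kap], hence at
     least [2 * b]. *)
  have bj : (b <= smin x j)%N.
    by rewrite leqNgt; apply/negP => /(nojump j mj); lia.
  have [c [c1 c2 c3 c4]] := long_coord s4' mj h1 h2 h3 bj.
  by exists c; split=> //; lia.
have hd := half_depth.
have glen := geod_len (hgam x); rewrite sgam in glen.
have sl : (s <= (gam x).1)%N by lia.
have [i Ai] := cover ((gam x).2 s).
have mi : meets (gam x) (A i) by exists s.
have i1 := kmin_le sl Ai; have i2 := kmax_ge sl Ai.
have [[x1 x2 x3 Az _] [x4 x5 x6 x7 x8]] := facts (hgam x) mi.
have [r1 r2] := entry_dist adjS conn C2 hq (hgam x) mi.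
rewrite sgam in x3 x4 r1 r2; rewrite -/(rad x i) in r1 r2.
have [il|il] := ltnP kap (ilen adj (gam x) (A i)).
  have [c hc] := covered s i (leqnn s) (leq_addr _ _) mi i1 i2 il.
  by exists (inr c).
set z := dplus (gam x) (A i) in Az x4 x5 x7.
have tz : tent adj C0 x (entries adj e A i z) (rad x i) = (rad x i).+1.
  by apply: tent_in => //; exists (gam x).
have lm0 : (0 < lm)%N by rewrite /lam.
have [t0|t0] := posnP (tent adj C0 x (excluders adj e A K z) (rad x i)).
  have hx : short_height adj e A kap K x (i, z) = (rad x i).+1.
    by rewrite /short_height /= tz t0 subn0.
  exists (inl (i, z)); rewrite hx /= x4; split.
  - by rewrite /z dplus_gam short_height_far//; lia.
  - apply: (@leq_trans ((lm * rad x i) %/ lm)); last by rewrite mulKn.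
    by apply: leq_div2r; lia.
  - lia.
  - apply/andP; split; lia.
have [u [[g [j [hg gu mg [l5 [ex1 ex2]]]]] hu _]] := tent_gt0 t0.
have kapK : kap%:R <= K by [].
have l5' : (kap < ilen adj g (A j))%N.
  rewrite ltnNge; apply/negP => le.
  have : (ilen adj g (A j))%:R <= kap%:R :> R by rewrite ler_nat.
  lra.
have ex1' : (d e (dminus g (A j)) + 2 * kap <= d e z)%N.
  by rewrite -(ler_nat R) natrD natrM; lra.
have ex2' : (d e z + 2 * kap <= d e (dplus g (A j)))%N.
  by rewrite -(ler_nat R) natrD natrM; lra.
have hu' : (C0 * d (gstart (gam x)) (gstart g) <= ndist adj (gstart (gam x)) (A i))%N.
  by rewrite sgam gu.
have [mj j1 j2 j3] :=
  excluded_covered adjS conn C1 C2 hq (hgam x) hg mi mg hu' l5' ex1' ex2'.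
have [c hc] := covered (smin x i) j i1 ltac:(lia) mj j1 j2 j3.
by exists (inr c).
Qed.

End Separation.

(** * Scales, the embedding and its two bounds *)

(** A coordinate determines its vertex up to [spread + kap], so vertices sampled with this step have
    distinct coordinates. *)
Definition tree_step (kap : nat) : nat := (spread kap + kap).+1.

Lemma tree_step_gt (kap : nat) : (kap < tree_step kap)%N.
Proof. by rewrite /tree_step ltnS leq_addl. Qed.

(** Powers of 2 compare [n] with [b - kap] and with [b'], so that repeated doubling transfers bounds
    for [rho] and [f] back to [n]; [2 ^ lam] replaces the factor [lam]. *)
Lemma scale_arith (kap n0 n : nat) :
  (64 * (tree_step kap + lam kap * n0.+1) < n)%N ->
  let b := (n %/ 64)%N in let b' := (b %/ lam kap)%N in
  [/\ (0 < b)%N, (n <= 128 * b)%N, (64 * b <= n)%N & (tree_step kap <= b)%N] /\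
  [/\ (n <= 2 ^ 8 * (b - kap))%N, (n0 < b')%N & (n <= 2 ^ (8 + lam kap) * b')%N].
Proof.
move=> large b b'.
have blo : (64 * b <= n)%N by rewrite mulnC; exact: leq_divM.
have bhi : (n < b.+1 * 64)%N by exact: ltn_ceil.
have bb : (tree_step kap + lam kap * n0.+1 <= b)%N.
  by rewrite leq_divRL// mulnC; exact: ltnW.
have st : (tree_step kap <= b)%N by apply: leq_trans bb; exact: leq_addr.
have nb' : (n0 < b')%N.
  by rewrite leq_divRL//; apply: leq_trans bb; rewrite mulnC; exact: leq_addl.
have h1 : (b < b'.+1 * lam kap)%N by exact: ltn_ceil.
have h2 : (b'.+1 * lam kap <= 2 * b' * lam kap)%N.
  by rewrite leq_mul2r; apply/orP; right; clear -nb'; move: (b') nb' => u; lia.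
have h3 : (b' * lam kap <= b' * 2 ^ lam kap)%N.
  by rewrite leq_mul2l ltnW ?orbT// ltn_expl.
rewrite expnD (_ : 2 ^ 8 = 256)%N// -mulnA (mulnC (2 ^ lam kap)%N).
move: (b' * 2 ^ lam kap)%N h3 => w h3.
rewrite -mulnA in h2; move: (b'.+1 * lam kap)%N (b' * lam kap)%N h1 h2 h3 => u v h1 h2 h3.
have kb : (64 * (2 * kap).+1 + kap < b)%N by exact: st.
move: (b) st kb blo bhi h1 => c st kb blo bhi h1.
by clear -st kb blo bhi h1 h2 h3 nb'; split; split=> //; lia.
Qed.

Section Embedding.
Variables (R : realType) (p : R).
Hypothesis hp : 1 < p.
Variables (X : choiceType) (adj : X -> X -> Prop).
Hypothesis adjS : forall x y, adj x y -> adj y x.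
Hypothesis conn : forall x y, exists n, walk adj n x y.
Variables (e : X) (I : choiceType) (A : I -> set X) (K : R) (kap : nat).
Hypothesis K0 : 0 < K.
Hypothesis hkap : forall n : nat, (n%:R <= K) = (n <= kap)%N.

Local Notation d := (gdist adj).
Local Notation geod := (is_geod adj e).

Hypothesis cover : forall x, exists i, A i x.
Hypothesis C1 : forall i g h, geod g -> geod h -> meets g (A i) -> meets h (A i) ->
  (d (dminus g (A i)) (dminus h (A i)) <= kap)%N.
Hypothesis C2 : forall i g h, geod g -> geod h ->
  (d (gstart g) (gstart h) <= 1)%N \/
    (4 * d (gstart g) (gstart h) <= ndist adj (gstart g) (A i))%N ->
  (meets g (A i) -> meets h (A i) -> (d (dplus g (A i)) (dplus h (A i)) <= kap)%N) /\
  (meets g (A i) -> ~ meets h (A i) -> (ilen adj g (A i) <= kap)%N).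
Hypothesis C3 : forall x, exists2 l : seq I, (size l <= kap)%N & forall i, A i x -> i \in l.
Hypothesis C4 : forall x (t : nat), exists2 l : seq I, (size l <= kap)%N &
  forall i, Ix adj e A K x i -> A i !=set0 -> ndist adj x (A i) = t -> i \in l.
Variables (bl : X -> nat -> seq X) (B : nat -> nat).
Hypothesis hbl : forall x r, [/\ uniq (bl x r), (size (bl x r) <= B r)%N &
        forall y, (d x y <= r)%N -> y \in bl x r].
Variable q : I -> X.
Hypothesis hq : forall i g, geod g -> meets g (A i) ->
  (d (dminus g (A i)) (q i) <= kap)%N /\ A i (q i).
Variable gam : X -> geo X.
Hypothesis gamP : forall x, geod (gam x) /\ gstart (gam x) = x.
Variables (Xi : I -> choiceType) (psi : forall i, X -> (Xi i -> R)) (rho : R -> R).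
Hypothesis hpsi : forall i x y, A i x -> A i y ->
  lple p (fun s : Xi i => psi x s - psi y s) (d x y)%:R.
Hypothesis hpsi_lower : forall i x y a, A i x -> A i y -> 0 <= a ->
  lple p (fun s : Xi i => psi x s - psi y s) a -> rho (d x y)%:R <= a.
Hypothesis hrho : concave_nonneg rho.

Variables (f eta : nat -> R) (N0 : nat) (Be c0 : R).
Hypothesis f0 : forall n, 0 <= f n.
Hypothesis hf : Cpc p f.
Hypothesis eta0 : forall t, 0 < eta t.
Hypothesis eta1 : forall r, eta r.+1 <= eta r.
Hypothesis eta2 : forall r, (eta r - eta r.+1) * r.+1%:R <= 2 * eta r.+1.
Hypothesis Be0 : 0 <= Be.
Hypothesis eta3 : forall n, \sum_(t < n) eta t `^ p <= Be `^ p.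
Hypothesis c00 : 0 < c0.
Hypothesis eta4 : forall r, c0 <= eta r * r.+1%:R.
Hypothesis eta5 : forall b r, (N0 <= b)%N -> (b <= r)%N ->
  f b `^ p <= b%:R * (eta r * r%:R) `^ p.

Let dsym := gdist_sym adjS conn.

Local Notation rad := (rad adj A).
Local Notation short := (short_height adj e A kap K).
Local Notation long := (long_height adj e A kap q).
Local Notation avg := (average adj e A kap bl q gam psi).

Definition coord : choiceType := ((I * X) + ((I * X) * nat) + {i : I & Xi i})%type.

Definition emb (x : X) (c : coord) : R :=
  match c with
  | inl (inl c) => eta (rad x c.1) * (short x c)%:R
  | inl (inr c) => eta (rad x c.1.1) * (long x c)%:R
  | inr k => avg x (tagged k)
  end.

Lemma emb_lip1 : exists2 C : R, 0 <= C & forall x y, (d x y <= 1)%N ->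
  lple p (fun c => emb x c - emb y c) C.
Proof.
have [Ca Ca0 hCa] := average_field_lip hp adjS conn C2 C3 hbl hq gamP hpsi
  eta0 eta1 Be0 eta3 c00 eta4.
pose Q := (2 * (tent_cst kap).+1)%N.
pose Ms := ((kap + B (Num.truncn (3 * K)) * kap) * B (2 * kap))%N.
pose Ml := ((2 * lam kap) * ((B kap * kap) * B kap))%N.
pose cst (M : nat) : R := (Q%:R + 4) * (M%:R * Be) + (Q%:R + 4) * (M%:R * Be).
have cst0 M : 0 <= cst M.
  have Q0 : 0 <= Q%:R + 4 :> R by rewrite addr_ge0.
  by rewrite /cst; apply: addr_ge0; apply: mulr_ge0 => //; exact: mulr_ge0.
exists (cst Ms + cst Ml + Ca); first exact: addr_ge0 (addr_ge0 (cst0 Ms) (cst0 Ml)) Ca0.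
move=> x y xy; have yx : (d y x <= 1)%N by rewrite dsym.
have csl := addr_ge0 (cst0 Ms) (cst0 Ml).
apply: (lple_sum_type hp csl Ca0); last exact: hCa.
apply: (lple_sum_type hp (cst0 Ms) (cst0 Ml)) => /=.
  apply: (tent_field_lip hp eta0 eta1 eta2 Be0 eta3 (S := (I * X)%type)
    (r := fun c => rad x c.1) (r' := fun c => rad y c.1)
    (t := short x) (t' := short y)
    (h := fun c => rad x c.1) (h' := fun c => rad y c.1) (Q := Q) (M := Ms)) => //.
  - by move=> c; exact: (rad_lip adjS conn A c.1 yx).
  - by move=> c; exact: (rad_lip adjS conn A c.1 xy).
  - by move=> c; exact: short_height_lip.
  - by move=> c; exact: short_height_lip.
  - by move=> c; exact: short_height_le.
  - move=> k; exact: (short_support adjS conn C2 C3 hbl hq gamP K0 C4).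
  - move=> k; exact: (short_support adjS conn C2 C3 hbl hq gamP K0 C4).
have fib u c : long u c != 0%N -> (domain_fiber A kap gam u c.1.1 c.2 <= rad u c.1.1)%N.
  case: c => [[i z] m] /(long_height_domain adjS conn C2 hq gamP) [mu _ _ mr].
  exact: (domain_fiber_le adjS conn C2 hq gamP).
apply: (tent_field_lip hp eta0 eta1 eta2 Be0 eta3 (S := ((I * X) * nat)%type)
    (r := fun c => rad x c.1.1) (r' := fun c => rad y c.1.1)
    (t := long x) (t' := long y)
    (h := fun c => domain_fiber A kap gam x c.1.1 c.2)
    (h' := fun c => domain_fiber A kap gam y c.1.1 c.2) (Q := Q) (M := Ml)) => //.
- by move=> c; exact: (rad_lip adjS conn A c.1.1 yx).
- by move=> c; exact: (rad_lip adjS conn A c.1.1 xy).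
- by move=> c; exact: long_height_lip.
- by move=> c; exact: long_height_lip.
- by move=> c; exact: long_height_le.
- by move=> c; exact: fib.
- by move=> c; exact: fib.
- move=> k; exact: (long_support adjS conn C2 C3 hbl hq gamP).
- move=> k; exact: (long_support adjS conn C2 C3 hbl hq gamP).
Qed.

Lemma emb_lip : exists2 C : R, 0 <= C & forall x y,
  lple p (fun c => emb x c - emb y c) (C * (d x y)%:R).
Proof.
have [C C0 hC] := emb_lip1; exists C => // x y.
have [n nE] : exists n, d x y = n by exists (d x y).
rewrite nE; elim: n x nE => [|n IH] x nE.
  by rewrite (gdist0_eq conn nE); apply: lple0 => // c; rewrite subrr.
have [z [xz zy]] := gdist_step conn nE.
apply: (lple_ext (v := fun c => (emb x c - emb z c) + (emb z c - emb y c))).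
  by move=> c; rewrite addrA subrK.
rewrite -nat1r mulrDr mulr1; apply: (lple_add hp) => //.
- exact: mulr_ge0.
- exact: hC.
- exact: IH.
Qed.

Lemma rho_double (t : R) k : 0 <= t -> rho (2 ^+ k * t) <= 2 ^+ k * rho t.
Proof.
have [r0 [rm rc]] := hrho.
move=> t0; elim: k => [|k IH]; first by rewrite !expr0 !mul1r.
have t1 : 0 <= 2 ^+ k * t by rewrite mulr_ge0// exprn_ge0.
have := rc (2 ^+ k * t) (2 ^+ k * t) t1 (lexx _).
rewrite subrr -mulr2n -[_ *+ 2]mulr_natl mulrA -exprS => h.
have h0 := r0 0 (lexx _); rewrite [X in _ <= X * _]exprS -[leRHS]mulrA; lra.
Qed.

Lemma f_double n k : f (2 ^ k * n)%N <= 2 ^+ k * f n.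
Proof.
elim: k => [|k IH]; first by rewrite expn0 expr0 mul1n mul1r.
have := concave_double f0 hf (2 ^ k * n).
rewrite addnn -mul2n mulnA -expnS => h.
rewrite [X in _ <= X * _]exprS -[leRHS]mulrA; lra.
Qed.

Let cb : R := (B (2 * kap))%:R * (1 * (4 * kap)%:R).

Let cb0 : 0 <= cb. Proof. by rewrite /cb mul1r mulr_ge0. Qed.

(** The coordinates of the piece [i] bound the difference of the averages by [a]. Replacing averages
    by their centres costs [2 * cb], undoing the cut costs [4 * kap], and the result is the
    difference of [psi] at two points at least [b - kap] apart. *)
Lemma emb_jump x y a i b : (0 < d x y)%N -> (d y e <= d x e)%N -> (0 < b)%N ->
  (d x y <= 128 * b)%N -> (64 * b <= d x y)%N ->
  0 <= a -> lple p (fun c => emb x c - emb y c) a ->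
  meets (gam x) (A i) -> (kmin (gam x) (A i) < b)%N -> (2 * b <= kmax (gam x) (A i))%N ->
  rho (b - kap)%:R <= a + (2 * cb + (4 * kap)%:R).
Proof.
move=> xy dep b0 bhi blo a0 hlp mx s1 s2.
have jf := jump_far adjS conn hq gamP xy dep b0 bhi blo mx s1 s2.
have [_ [rm _]] := hrho.
have A0 : A i !=set0 by exists (dplus (gam x) (A i)); have [_ ?] := kmin_spec mx.
set z0 := proj A q (gam x) i in jf; set z1 := proj A q (gam y) i in jf.
have [Az0 Aq] : A i z0 /\ A i (q i) := proj_A adjS conn hq (gamP x).1 A0.
have [Az1 _] : A i z1 /\ A i (q i) := proj_A adjS conn hq (gamP y).1 A0.
apply: (@le_trans _ _ (rho (d z0 z1)%:R)); first by apply: rm; rewrite ?ler_nat.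
have cutb z : A i z ->
    lple p (fun s : Xi i => (psi z s - psi (q i) s) - cut adj kap q psi z s) (2 * kap)%:R.
  move=> Az; have [le|gt] := leqP (d z (q i)) (2 * kap).
    apply: (lple_mono hp _ _ _ (hpsi Az Aq)) => //; last by rewrite ler_nat.
    by move=> s; rewrite /cut le subr0.
  by apply: lple0 => // s; rewrite /cut leqNgt gt subrr.
have ax := average_center hp adjS conn C2 hbl hq gamP hpsi x (i := i).
have ay := average_center hp adjS conn C2 hbl hq gamP hpsi y (i := i).
rewrite -/z0 -/cb in ax; rewrite -/z1 -/cb in ay.
have axy : lple p (fun s : Xi i => avg x s - avg y s) a.
  apply: (lple_inj (S := coord)
    (f := fun s : Xi i => inr (existT (fun i : I => Xi i : Type) i s))
    (v := fun c => emb x c - emb y c)) hlp.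
  by move=> s t [] /eqP; rewrite eq_Tagged => /eqP.
have k0 : 0 <= (2 * kap)%:R :> R by [].
apply: (hpsi_lower Az0 Az1); first by rewrite addr_ge0// addr_ge0// mulr_ge0.
have h1 := lple_sub hp k0 k0 (cutb z0 Az0) (cutb z1 Az1).
have h2 := lple_sub hp cb0 cb0 ay ax.
have h3 := lple_add hp (addr_ge0 k0 k0) (addr_ge0 cb0 cb0) h1 h2.
have h4 := lple_add hp (addr_ge0 (addr_ge0 k0 k0) (addr_ge0 cb0 cb0)) a0 h3 axy.
apply: (lple_mono hp _ _ _ h4).
- move=> s; rewrite le_eqVlt; apply/orP; left; apply/eqP.
  congr (`| _ |); ring.
- by rewrite !addr_ge0.
- by rewrite !natrM; lra.
Qed.

Local Notation spr := (tree_step kap).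

(** About [b / tree_step] sampled vertices yield distinct coordinates, each at least [beta] at [x]
    and 0 at [y]. The [p]-th powers add up to a fixed proportion of [f(b')^p]. *)
Lemma emb_tree x y a b : (0 < d x y)%N -> (d y e <= d x e)%N -> (0 < b)%N ->
  (d x y <= 128 * b)%N -> (64 * b <= d x y)%N ->
  0 <= a -> lple p (fun c => emb x c - emb y c) a ->
  (forall i, meets (gam x) (A i) -> (kmin (gam x) (A i) < b)%N ->
     (kmax (gam x) (A i) < 2 * b)%N) ->
  (spr <= b)%N -> (N0 <= b %/ lam kap)%N -> (0 < b %/ lam kap)%N ->
  f (b %/ lam kap) <= (4 * spr)%:R * a.
Proof.
move=> xy dep b0 bhi blo a0 hlp nojump sb Nb b'0.
set b' := (b %/ lam kap)%N in Nb b'0 *.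
have hp1 : 1 <= p by exact: ltW.
have b'R : 0 < b'%:R :> R by rewrite ltr0n.
(* By [eta5], [eta r * r] is at least [2 * beta] for [b' <= r]; the half is lost because a height
   may be only [r / 2]. *)
pose beta := (f b' `^ p / b'%:R) `^ p^-1 / 2.
have root0 : 0 <= f b' `^ p / b'%:R by apply: divr_ge0; rewrite ?powR_ge0.
have beta0 : 0 <= beta by rewrite /beta divr_ge0// powR_ge0.
have betap : (2 * beta) `^ p = f b' `^ p / b'%:R.
  rewrite /beta mulrCA divff// mulr1 -powRrM mulVf ?powRr1//.
  by rewrite gt_eqF// (lt_trans _ hp).
have big r h : (b' <= r)%N -> (r <= 2 * h)%N -> beta <= eta r * h%:R.
  move=> br rh; suff : 2 * beta <= eta r * r%:R.
    have : eta r * r%:R <= eta r * (2 * h%:R).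
      by apply: ler_wpM2l; [exact: ltW|rewrite -natrM ler_nat].
    rewrite mulrCA; lra.
  apply: (powR_ler_inv hp1); first by rewrite mulr_ge0.
    by rewrite mulr_ge0// ltW.
  by rewrite betap ler_pdivrMr// mulrC; exact: eta5.
pose base (c : coord) : nat := match c with
  | inl (inl c) => d x c.2
  | inl (inr c) => (d x c.1.2 + spread kap * c.2)%N
  | inr _ => 0%N end.
pose N := (b %/ spr)%N.
(* The offset is the least one [short_coord] accepts, and all samples with [k < N] stay below a
   quarter of [d x y]. *)
pose s k := (2 * b + kap + k * spr)%N.
have [i0 _] := cover e.
have kK : kap%:R <= K by rewrite hkap.
have Kk n : n%:R <= K -> (n <= kap)%N by rewrite hkap.
have /choice [c hc] : forall k, exists c : coord, (k < N)%N ->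
    beta <= `|emb x c - emb y c| /\ (base c <= s k <= base c + (spread kap + kap))%N.
  move=> k; have [kN|kN] := ltnP k N; last by exists (inl (inl (i0, e))).
  have ks : (k * spr <= b)%N.
    apply: leq_trans (leq_divM b spr); rewrite leq_mul2r; apply/orP; right; exact: ltnW.
  have kb : (kap <= b)%N by apply: leq_trans sb; exact: ltnW (tree_step_gt kap).
  have s4 : (4 * s k <= d x y)%N.
    rewrite /s; move: (k * spr)%N ks kb blo => m ks kb blo; clear -ks kb blo; lia.
  have s2 : (2 * b + kap <= s k)%N by rewrite /s leq_addr.
  have := short_coord adjS conn cover C1 C2 hq gamP xy dep b0
    bhi blo K0 kK Kk (s := s k) s4 s2 nojump.
  move=> [[c|c] [c1 c2 c3 c4]].
    exists (inl (inl c)) => _; split=> //=.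
    by rewrite c1 mulr0 subr0 ger0_norm ?mulr_ge0 ?(ltW (eta0 _))//; exact: big.
  exists (inl (inr c)) => _; split=> //=.
  by rewrite c1 mulr0 subr0 ger0_norm ?mulr_ge0 ?(ltW (eta0 _))//; exact: big.
have inj k l : (k < N)%N -> (l < N)%N -> c k = c l -> k = l.
  move=> kN lN ckl; have [_ h1] := hc k kN; have [_ h2] := hc l lN.
  rewrite -ckl in h2.
  have sle u v : (u < v)%N -> (s u + (spread kap + kap).+1 <= s v)%N.
    by move=> uv; rewrite /s -addnA -mulSnr leq_add2l leq_mul2r uv orbT.
  move: (s) sle h1 h2 => s' sle h1 h2; clear -sle h1 h2.
  by have [kl|kl|//] := ltngtP k l; have := sle _ _ kl; lia.
have low := lple_lower hp beta0 hlp inj (fun k kN => (hc k kN).1).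
have N1 : (0 < N)%N by rewrite /N divn_gt0.
have bN : (b' <= 2 * spr * N)%N.
  have h1 : (b' <= b)%N by rewrite leq_div.
  have h2 : (b < N.+1 * spr)%N by rewrite /N; exact: ltn_ceil.
  have h3 : (spr <= spr * N)%N by apply: leq_pmulr.
  rewrite mulSn (mulnC N) in h2; rewrite -mulnA.
  by clear -h1 h2 h3; move: (b') (spr * N)%N h1 h2 h3 => u v; lia.
apply: (powR_ler_inv hp1) => //; first by rewrite mulr_ge0.
have -> : f b' `^ p = b'%:R * (2 `^ p * beta `^ p).
  by rewrite -powRM// betap mulrC divfK// gt_eqF.
apply: (@le_trans _ _ ((2 * spr)%:R * 2 `^ p * a `^ p)).
  have -> : b'%:R * (2 `^ p * beta `^ p) = 2 `^ p * (b'%:R * beta `^ p) by ring.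
  rewrite (mulrC _ (2 `^ p)) -[leRHS]mulrA; apply: ler_wpM2l; first exact: powR_ge0.
  apply: (@le_trans _ _ ((2 * spr)%:R * (N%:R * beta `^ p))).
    rewrite mulrA -natrM; apply: ler_wpM2r; first exact: powR_ge0.
    by rewrite ler_nat.
  by apply: ler_wpM2l.
rewrite powRM//; apply: ler_wpM2r; first exact: powR_ge0.
have -> : (4 * spr)%:R = (2 * spr)%:R * 2 :> R by rewrite -natrM mulnAC.
rewrite powRM//; apply: ler_wpM2r; first exact: powR_ge0.
have s1 : 1 <= (2 * spr)%:R :> R by rewrite ler1n muln_gt0 (leq_ltn_trans _ (tree_step_gt kap)).
rewrite -[leLHS]powRr1//.
exact: ler_powR.
Qed.

(** By symmetry [x] is at least as far from [e] as [y]. Distances up to [64 * b0] are absorbed by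
    the constant [f (64 * b0)]. Beyond, a long domain starting early gives the bound by [rho], and
    its absence the bound by [f]. *)
Lemma emb_lower : exists2 C : R, 0 <= C & forall x y a, 0 <= a ->
  lple p (fun c => emb x c - emb y c) a ->
  Num.min (rho (d x y)%:R) (f (d x y)) <= C * a + C.
Proof.
have [rho0 [rm _]] := hrho.
pose b0 := (spr + lam kap * N0.+1)%N.
pose J := (8 + lam kap)%N.
pose Ca : R := 2 * cb + (4 * kap)%:R.
pose C : R := 2 ^+ 8 + 2 ^+ 8 * Ca + 2 ^+ J * (4 * spr)%:R + f (64 * b0)%N.
have Ca0 : 0 <= Ca by rewrite /Ca addr_ge0// mulr_ge0.
have p8 : 0 <= 2 ^+ 8 :> R by rewrite exprn_ge0.
have t1 : 0 <= 2 ^+ 8 * Ca by rewrite mulr_ge0.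
have t2 : 0 <= 2 ^+ J * (4 * spr)%:R :> R by rewrite mulr_ge0// exprn_ge0.
have t3 := f0 (64 * b0)%N.
have C0 : 0 <= C by rewrite /C !addr_ge0.
have [[fm _] _] := hf.
suff main x y a : (d y e <= d x e)%N -> 0 <= a ->
    lple p (fun c => emb x c - emb y c) a ->
    Num.min (rho (d x y)%:R) (f (d x y)) <= C * a + C.
  exists C => // x y a a0 h; have [le|lt] := leqP (d y e) (d x e); first exact: main.
  rewrite (dsym x y); apply: (main y x a (ltnW lt) a0).
  apply: (lple_ext (v := fun c => - (emb x c - emb y c))); last exact: lple_opp.
  by move=> c; rewrite opprB.
move=> dep a0 hlp.
have Caa : 0 <= (2 ^+ 8 * Ca + 2 ^+ J * (4 * spr)%:R + f (64 * b0)%N) * a.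
  by rewrite mulr_ge0// !addr_ge0.
have Cab : 0 <= 2 ^+ 8 * a by rewrite mulr_ge0.
have Cac : 0 <= (2 ^+ 8 + 2 ^+ 8 * Ca + f (64 * b0)%N) * a.
  by rewrite mulr_ge0// !addr_ge0.
have [small|large] := leqP (d x y) (64 * b0).
  rewrite ge_min; apply/orP; right.
  have h := fm _ _ small; rewrite /C; lra.
have xy : (0 < d x y)%N by exact: leq_ltn_trans large.
have := scale_arith large; rewrite /= -/J.
move: (d x y %/ 64)%N => b [[bgt0 bhi blo sb] [nbk Nb' hJ]].
have [[i [mi [s1 s2]]]|nojump] := pselect (exists i, meets (gam x) (A i) /\
    (kmin (gam x) (A i) < b)%N /\ (2 * b <= kmax (gam x) (A i))%N).
  have h := emb_jump xy dep bgt0 bhi blo a0 hlp mi s1 s2.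
  rewrite -/Ca in h.
  have h1 : rho (d x y)%:R <= rho (2 ^+ 8 * (b - kap)%:R).
    by apply: rm => //; rewrite -natrX -natrM ler_nat.
  have h2 := rho_double 8 (ler0n R (b - kap)).
  have h3 : 2 ^+ 8 * rho (b - kap)%:R <= 2 ^+ 8 * (a + Ca) by apply: ler_wpM2l.
  rewrite ge_min; apply/orP; left.
  rewrite mulrDr in h3; rewrite /C; move: Caa; rewrite !mulrDl; lra.
have nj i : meets (gam x) (A i) -> (kmin (gam x) (A i) < b)%N ->
     (kmax (gam x) (A i) < 2 * b)%N.
  by move=> mi s1; rewrite ltnNge; apply/negP => s2; apply: nojump; exists i.
have h := emb_tree xy dep bgt0 bhi blo a0 hlp nj sb (ltnW Nb') (leq_ltn_trans (leq0n _) Nb').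
set b' := (b %/ lam kap)%N in Nb' hJ h.
have h1 := fm _ _ hJ.
have h2 := f_double b' J.
have h3 : 2 ^+ J * f b' <= 2 ^+ J * ((4 * spr)%:R * a).
  by apply: ler_wpM2l => //; rewrite exprn_ge0.
rewrite ge_min; apply/orP; right.
rewrite mulrA in h3; rewrite /C; move: Cac; rewrite !mulrDl; lra.
Qed.

End Embedding.

(** * Passage to integer constants and conclusion *)

Lemma dset_ndistE (R : realType) (X : choiceType) (adj : X -> X -> Prop)
    (conn : forall x y, exists n, walk adj n x y) (x : X) (P : set X) :
  dset (R := R) adj x P = (ndist adj x P)%:R.
Proof.
have [P0|P0] := pselect (P !=set0); first exact: dset_ndist.
by rewrite dset_set0// ndist_set0.
Qed.

Theorem theorem5p4 (R : realType) (p : R) (hp : 1 < p)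
  (X : choiceType) (adj : X -> X -> Prop) (hX : bounded_geometry_graph adj)
  (e : X) (I : countType) (A : I -> set X)
  (hcov : forall x, exists i, A i x)
  (hSPQR : SPQR (R := R) adj A e)
  (Xi : I -> choiceType) (psi : forall i, X -> (Xi i -> R)) (rho' : R -> R)
  (hrho' : concave_nonneg rho')
  (hpsi_lp : forall i x, A i x -> lp_mem p (psi i x))
  (hpsi : forall i x y, A i x -> A i y ->
     rho' (gdist adj x y)%:R <= lpnorm p (fun s => psi i x s - psi i y s)
     /\ lpnorm p (fun s => psi i x s - psi i y s) <= (gdist adj x y)%:R) :
  forall f : nat -> R, (forall n, 0 <= f n) -> Cpc p f ->
  exists (S : choiceType) (phi : X -> (S -> R)),
    (forall x, lp_mem p (phi x)) /\
    exists C : R, forall x y,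
      Num.min (rho' (gdist adj x y)%:R) (f (gdist adj x y))
        <= C * lpnorm p (fun s => phi x s - phi y s) + C /\
      lpnorm p (fun s => phi x s - phi y s) <= C * (gdist adj x y)%:R + C.
Proof.
move=> f f0 hf.
(* The weight requires a positive value of [f]. If [f] vanishes identically, so does the upper bound
   for the minimum, and a constant map will do. *)
have [[n1 fn1]|fz] := pselect (exists n, 0 < f n); last first.
  exists X, (fun _ _ => 0); split.
    by move=> x; apply: (@lple_lp_mem _ _ _ _ 0); apply: lple0.
  exists 0 => x y; split; last first.
    by rewrite mul0r add0r; apply: lpnorm_le => //; apply: lple0 => // s; rewrite oppr0.
  rewrite mul0r add0r ge_min; apply/orP; right.
  by rewrite leNgt; apply/negP => h; apply: fz; exists (gdist adj x y).
have [adjS [_ [conn [D hD]]]] := hX.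
have [K [K0 [C1 [C2 [C3 [_ C4]]]]]] := hSPQR.
pose kap := Num.truncn K.
have hkap (n : nat) : (n%:R <= K) = (n <= kap)%N by rewrite /kap truncn_ge_nat// ltW.
have dE := dset_ndistE R conn.
have C1' i g h : is_geod adj e g -> is_geod adj e h -> meets g (A i) -> meets h (A i) ->
    (gdist adj (dminus g (A i)) (dminus h (A i)) <= kap)%N.
  by move=> hg hh mg mh; rewrite -hkap; exact: C1.
have C2' i g h : is_geod adj e g -> is_geod adj e h ->
    (gdist adj (gstart g) (gstart h) <= 1)%N \/
      (4 * gdist adj (gstart g) (gstart h) <= ndist adj (gstart g) (A i))%N ->
    (meets g (A i) -> meets h (A i) ->
       (gdist adj (dplus g (A i)) (dplus h (A i)) <= kap)%N) /\
    (meets g (A i) -> ~ meets h (A i) -> (ilen adj g (A i) <= kap)%N).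
  move=> hg hh hd; rewrite -!hkap; apply: (C2 i (gstart g) (gstart h)) => //.
  rewrite dE le_max; apply/orP; case: hd => hd; [right|left].
    by rewrite (ler_nat _ _ 1).
  by rewrite ler_pdivlMr// -natrM ler_nat mulnC.
have C3' x : exists2 l : seq I, (size l <= kap)%N & forall i, A i x -> i \in l.
  by have [_ [l [ml sl]]] := C3 x; exists l => //; rewrite -hkap.
have C4' x (t : nat) : exists2 l : seq I, (size l <= kap)%N &
    forall i, Ix adj e A K x i -> A i !=set0 -> ndist adj x (A i) = t -> i \in l.
  have [l [ml sl]] := C4 x t; exists l; first by rewrite -hkap.
  by move=> i hi _ ht; apply: ml; split=> //; rewrite dE ht.
have [bl [B hbl]] := finite_balls conn hD.
have [q hq] := exits_ex adjS conn C1'.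
have /choice [gam gamP] := geod_ex conn e.
have hpsi_mem i x y : A i x -> A i y -> lp_mem p (fun s => psi i x s - psi i y s).
  move=> Ax Ay; have hx := lp_memP hp (hpsi_lp _ _ Ax).
  have hy := lp_memP hp (hpsi_lp _ _ Ay).
  exact: lple_lp_mem (lple_sub hp (lpnorm_ge0 _ _) (lpnorm_ge0 _ _) hx hy).
have hpsi_up i x y : A i x -> A i y ->
    lple p (fun s => psi i x s - psi i y s) (gdist adj x y)%:R.
  move=> Ax Ay; have [_ up] := hpsi i x y Ax Ay.
  by apply: (lple_mono hp) up (lp_memP hp (hpsi_mem i x y Ax Ay)) => //; exact: lpnorm_ge0.
have hpsi_low i x y a : A i x -> A i y -> 0 <= a ->
    lple p (fun s => psi i x s - psi i y s) a -> rho' (gdist adj x y)%:R <= a.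
  move=> Ax Ay a0 h; have [low _] := hpsi i x y Ax Ay.
  exact: le_trans low (lpnorm_le hp a0 h).
have [eta [N0 [Be [c0 [[eta0 eta1 eta2 Be0 eta3] [c00 eta4 eta5]]]]]] :=
  weight_ex hp f0 hf fn1.
pose Phi := emb adj e A K kap bl q gam psi eta.
have [Cu Cu0 hCu] : exists2 C : R, 0 <= C & forall x y,
    lple p (fun c => Phi x c - Phi y c) (C * (gdist adj x y)%:R).
  exact: (emb_lip hp adjS conn K0 C2' C3' C4' hbl hq gamP hpsi_up eta0 eta1 eta2
    Be0 eta3 c00 eta4).
have [Cl Cl0 hCl] : exists2 C : R, 0 <= C & forall x y a, 0 <= a ->
    lple p (fun c => Phi x c - Phi y c) a ->
    Num.min (rho' (gdist adj x y)%:R) (f (gdist adj x y)) <= C * a + C.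
  exact: (emb_lower hp adjS conn K0 hkap hcov C1' C2' hbl hq gamP hpsi_up hpsi_low
    hrho' f0 hf eta0 eta5).
have Phid x y : (fun s => Phi x s - Phi e s - (Phi y s - Phi e s)) =
    (fun s => Phi x s - Phi y s).
  by apply/funext => s; ring.
(* Only differences of [Phi] are known to be in [l^p], so the value at [e] is subtracted. *)
exists (coord X Xi), (fun x s => Phi x s - Phi e s); split.
  by move=> x; exact: lple_lp_mem (hCu x e).
exists (Cl + Cu) => x y; rewrite Phid.
have n0 := lpnorm_ge0 p (fun s => Phi x s - Phi y s).
split.
  have h := hCl x y _ n0 (lp_memP hp (lple_lp_mem (hCu x y))).
  have : 0 <= Cu * lpnorm p (fun s => Phi x s - Phi y s) by exact: mulr_ge0.
  rewrite mulrDl; lra.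
have d0 : 0 <= (gdist adj x y)%:R :> R by [].
have h : lpnorm p (fun s => Phi x s - Phi y s) <= Cu * (gdist adj x y)%:R.
  by apply: lpnorm_le => //; exact: mulr_ge0.
have : 0 <= Cl * (gdist adj x y)%:R by exact: mulr_ge0.
rewrite mulrDl; lra.
Qed.
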